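(* Let $\Omega\subseteq\mathbb H$ be an axially symmetric open set, $f$ a left slice hyperholomorphic function on $\Omega$, and $p\in\mathbb H$. Assume that $f$ admits the $*$-Laurent expansion $$f(q)=\sum_{n=0}^\infty(q-p)^{*n}a_n+\sum_{n=1}^\infty(q-p)^{-*n}a_{-n},\qquad\{a_n\}_{n\in\mathbb Z}\subset\mathbb H,$$ convergent absolutely and uniformly on the compact subsets of $\Omega(p,R_1,R_2)\subset\Omega$, where $\frac1{R_2}=\limsup_{n\to\infty}|a_n|^{1/n}$, $R_1=\limsup_{n\to\infty}|a_{-n}|^{1/n}$ and $0<R_1<R_2$. Then, for $q\in\Omega(p,R_1,R_2)$, $$\bar Df(q)=\sum_{n=0}^\infty\widetilde P_{2,n}(q,p)c_n+\sum_{n=1}^\infty\mathcal R_{2,n}(q,p)\,\mathcal Q_{c,p}^{-n-1}(q)\,c_{-n},$$ where $c_n=2(n+1)a_{n+1}$ for $n\ge0$ and $c_{-n}=-2a_{-n}$ for $n\ge1$.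
   Context: $\mathbb H$ denotes the quaternions $q=q_0+q_1e_1+q_2e_2+q_3e_3$ with the usual relations ($e_i^2=-1$, $e_1e_2=-e_2e_1=e_3$, $e_2e_3=-e_3e_2=e_1$, $e_3e_1=-e_1e_3=e_2$), $\underline q=q_1e_1+q_2e_2+q_3e_3$, $\bar q=q_0-\underline q$, $\mathbb S=\{\underline q:|\underline q|=1\}$, $\mathbb C_I=\mathbb R+I\mathbb R$ for $I\in\mathbb S$, $[q]=\{q_0+I|\underline q|:I\in\mathbb S\}$; a set $U$ is axially symmetric if $[q]\subset U$ for all $q\in U$. Slice hyperholomorphic: for $U$ axially symmetric open and $\mathcal U=\{(u,v)\in\mathbb R^2:u+\mathbb Sv\subset U\}$, $f:U\to\mathbb H$ is left slice hyperholomorphic if $f(u+Iv)=\alpha(u,v)+I\beta(u,v)$ for all $(u,v)\in\mathcal U$, $I\in\mathbb S$, with $C^1$ functions $\alpha,\beta:\mathcal U\to\mathbb H$, $\alpha$ even and $\beta$ odd in $v$, satisfying $\partial_u\alpha=\partial_v\beta$, $\partial_v\alpha=-\partial_u\beta$. $\bar D=\partial_{q_0}-e_1\partial_{q_1}-e_2\partial_{q_2}-e_3\partial_{q_3}$ acting from the left, in $q$. $\Omega(p,R_1,R_2)$: choose $I\in\mathbb S$ with $p\in\mathbb C_I$, let $S_I(p,R_1,R_2)=\{z\in\mathbb C_I:R_1<|z-p|<R_2\}$; then $\Omega(p,R_1,R_2)=\{x+yJ:J\in\mathbb S,\ x,y\in\mathbb R,\ x+yI\text{ and }x-yI\in S_I(p,R_1,R_2)\}$.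 $*$-powers and products (left $*$-product in $q$): $(q-p)^{*m}=\sum_{i=0}^m\binom mi q^i(-p)^{m-i}$, $(\bar q-p)^{*k}=\sum_{j=0}^k\binom kj\bar q^j(-p)^{k-j}$, $(q-p)^{*m}*(\bar q-p)^{*k}=(\bar q-p)^{*k}*(q-p)^{*m}=\sum_{i=0}^m\sum_{j=0}^k\binom mi\binom kj q^i\bar q^j(-p)^{m-i+k-j}$; for $q\notin[p]$, $n\ge1$, $(q-p)^{-*n}=(q^2-2p_0q+|p|^2)^{-n}(q-\bar p)^{*n}$ with $p_0=\mathrm{Re}(p)$. $\widetilde P_{2,n}(q,p)=(q-p)^{*n}+\frac1{n+1}\sum_{k=1}^{n+1}(q-p)^{*(n+1-k)}*(\bar q-p)^{*(k-1)}$ ($n\ge0$); $\mathcal R_{2,n}(q,p)=n(\bar q-p)^{*(n+1)}+\sum_{k=0}^{n-1}(\bar q-p)^{*(n-k)}*(q-p)^{*(k+1)}$ ($n\ge1$); $\mathcal Q_{c,p}^{-m}(q)=(p^2-2q_0p+|q|^2)^{-m}$. *)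

(* Defs.v *)
From Stdlib Require Import Reals Lra ZArith List.
From Coquelicot Require Import Coquelicot.
Open Scope R_scope.

(** * Quaternions *)

(* [(q0, q1, q2, q3)] stands for q0 + q1 e1 + q2 e2 + q3 e3.  The additive,
   real-linear, uniform and normed structures are those of the product R^4
   (Coquelicot's product norm is the Euclidean one, see [norm_HE]). *)
Definition H : Type := (R * R * R * R)%type.

Definition mkH (q0 q1 q2 q3 : R) : H := (q0, q1, q2, q3).
Definition Hre (q : H) : R := fst (fst (fst q)).
Definition Him1 (q : H) : R := snd (fst (fst q)).
Definition Him2 (q : H) : R := snd (fst q).
Definition Him3 (q : H) : R := snd q.

Definition H_R4 : NormedModule R_AbsRing :=
  prod_NormedModule R_AbsRing
    (prod_NormedModule R_AbsRing
      (prod_NormedModule R_AbsRing R_NormedModule R_NormedModule)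
      R_NormedModule)
    R_NormedModule.

Canonical H_UniformSpace :=
  UniformSpace.Pack H (UniformSpace.class H_R4) H.
Canonical H_AbelianMonoid :=
  AbelianMonoid.Pack H (AbelianMonoid.class H_R4) H.
Canonical H_AbelianGroup :=
  AbelianGroup.Pack H (AbelianGroup.class H_R4) H.
Canonical H_ModuleSpace :=
  ModuleSpace.Pack R_Ring H (ModuleSpace.class R_Ring H_R4) H.
Canonical H_NormedModuleAux :=
  NormedModuleAux.Pack R_AbsRing H (NormedModuleAux.class R_AbsRing H_R4) H.
Canonical H_NormedModule :=
  NormedModule.Pack R_AbsRing H (NormedModule.class R_AbsRing H_R4) H.

Definition Hone : H := mkH 1 0 0 0.

Definition Hmult (p q : H) : H :=
  mkH (Hre p * Hre q - Him1 p * Him1 q - Him2 p * Him2 q - Him3 p * Him3 q)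
      (Hre p * Him1 q + Him1 p * Hre q + Him2 p * Him3 q - Him3 p * Him2 q)
      (Hre p * Him2 q - Him1 p * Him3 q + Him2 p * Hre q + Him3 p * Him1 q)
      (Hre p * Him3 q + Him1 p * Him2 q - Him2 p * Him1 q + Him3 p * Hre q).

Lemma mkH_ext (a b c d a' b' c' d' : R) :
  a = a' -> b = b' -> c = c' -> d = d' -> mkH a b c d = mkH a' b' c' d'.
Proof. intros; subst; reflexivity. Qed.

Ltac H_ring :=
  repeat match goal with x : H |- _ => destruct x as [[[? ?] ?] ?] end;
  apply mkH_ext;
  unfold Hmult, Hone, mkH, Hre, Him1, Him2, Him3, plus, opp, scal; simpl;
  unfold plus, opp, scal, mult; simpl;
  unfold mult; simpl; ring.

Lemma Hmult_assoc (x y z : H) : Hmult x (Hmult y z) = Hmult (Hmult x y) z.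
Proof. H_ring. Qed.

Lemma Hmult_1_r (x : H) : Hmult x Hone = x.
Proof. H_ring. Qed.

Lemma Hmult_1_l (x : H) : Hmult Hone x = x.
Proof. H_ring. Qed.

Lemma Hmult_plus_l (x y z : H) :
  Hmult (plus x y) z = plus (Hmult x z) (Hmult y z).
Proof. H_ring. Qed.

Lemma Hmult_plus_r (x y z : H) :
  Hmult x (plus y z) = plus (Hmult x y) (Hmult x z).
Proof. H_ring. Qed.

Definition H_Ring_mixin :=
  Ring.Mixin H_AbelianGroup Hmult Hone
    Hmult_assoc Hmult_1_r Hmult_1_l Hmult_plus_l Hmult_plus_r.
Canonical H_Ring :=
  Ring.Pack H
    (Ring.Class H (AbelianGroup.class H_AbelianGroup) H_Ring_mixin) H.

Declare Scope H_scope.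
Delimit Scope H_scope with H.
Bind Scope H_scope with H.
Notation "x + y" := (@plus H_AbelianMonoid x y) : H_scope.
Notation "- x" := (@opp H_AbelianGroup x) : H_scope.
Notation "x - y" := (@minus H_AbelianGroup x y) : H_scope.
Notation "x * y" := (@mult H_Ring x y) : H_scope.
Notation "x ^ n" := (@pow_n H_Ring x n) : H_scope.
Notation "r *: x" := (@scal R_Ring H_ModuleSpace r%R x)
  (at level 40, left associativity) : H_scope.

Definition e1 : H := mkH 0 1 0 0.
Definition e2 : H := mkH 0 0 1 0.
Definition e3 : H := mkH 0 0 0 1.

Lemma quaternion_relations :
  ((e1 * e1 = - Hone) /\ (e2 * e2 = - Hone) /\ (e3 * e3 = - Hone) /\
   (e1 * e2 = e3) /\ (e2 * e1 = - e3) /\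
   (e2 * e3 = e1) /\ (e3 * e2 = - e1) /\
   (e3 * e1 = e2) /\ (e1 * e3 = - e2))%H.
Proof. repeat split; unfold e1, e2, e3, mult; simpl; H_ring. Qed.

Definition RtoH (x : R) : H := mkH x 0 0 0.
Definition Hvec (q : H) : H := mkH 0 (Him1 q) (Him2 q) (Him3 q).
Definition Hconj (q : H) : H := (RtoH (Hre q) - Hvec q)%H.
Definition Hmod (q : H) : R :=
  sqrt (Hre q ^ 2 + Him1 q ^ 2 + Him2 q ^ 2 + Him3 q ^ 2).

(* The inverse of a nonzero quaternion; the value at 0 is irrelevant. *)
Definition Hinv (q : H) : H := ((/ (Hmod q ^ 2)) *: Hconj q)%H.

Lemma norm_HE (q : H) : norm q = Hmod q.
Proof.
destruct q as [[[a b] c] d].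
unfold Hmod, Hre, Him1, Him2, Him3, norm; simpl.
unfold prod_norm, norm; simpl.
unfold prod_norm, norm; simpl.
unfold prod_norm, norm; simpl.
unfold abs; simpl.
assert (HR : forall x, Rabs x * (Rabs x * 1) = x * (x * 1)).
{ intros x; rewrite !Rmult_1_r, <- Rabs_mult.
  apply Rabs_pos_eq, Rle_0_sqr. }
assert (HS : forall x, 0 <= x -> sqrt x * (sqrt x * 1) = x).
{ intros x Hx; rewrite Rmult_1_r; now apply sqrt_sqrt. }
rewrite !HR, !HS; try reflexivity; nra.
Qed.

Lemma Hmult_inv_r (q : H) : q <> RtoH 0 -> (q * Hinv q)%H = Hone.
Proof.
intros Hq.
assert (HS : 0 <= Hre q ^ 2 + Him1 q ^ 2 + Him2 q ^ 2 + Him3 q ^ 2) by nra.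
assert (Hm : Hmod q ^ 2 = Hre q ^ 2 + Him1 q ^ 2 + Him2 q ^ 2 + Him3 q ^ 2).
{ unfold Hmod; rewrite <- Rsqr_pow2; now apply Rsqr_sqrt. }
unfold Hinv; rewrite Hm; clear Hm.
destruct q as [[[a b] c] d].
unfold Hre, Him1, Him2, Him3 in *; simpl fst in *; simpl snd in *.
assert (Hn : a ^ 2 + b ^ 2 + c ^ 2 + d ^ 2 <> 0).
{ intros E; apply Hq.
  assert (a = 0) by nra; assert (b = 0) by nra;
  assert (c = 0) by nra; assert (d = 0) by nra; now subst. }
apply mkH_ext; unfold Hconj, RtoH, Hvec, mkH, Hre, Him1, Him2, Him3; simpl;
  unfold minus, plus, opp, scal; simpl; unfold plus, opp, scal; simpl;
  unfold plus, opp, scal, mult; simpl; field; contradict Hn; nra.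
Qed.

(** * Axially symmetric sets and slice hyperholomorphic functions *)

Definition sphere (I : H) : Prop := Hre I = 0 /\ Hmod I = 1.

Definition slice_pt (u v : R) (I : H) : H := (RtoH u + v *: I)%H.

(* C_I = R + I R *)
Definition C_slice (I z : H) : Prop := exists x y : R, z = slice_pt x y I.

(* [Hclass q] is [q]. *)
Definition Hclass (q x : H) : Prop :=
  exists I, sphere I /\ x = slice_pt (Hre q) (Hmod (Hvec q)) I.

Definition axially_symmetric (U : H -> Prop) : Prop :=
  forall q, U q -> forall x, Hclass q x -> U x.

(* {(u,v) : u + S v is contained in U} *)
Definition slice_domain (U : H -> Prop) (w : R * R) : Prop :=
  forall I, sphere I -> U (slice_pt (fst w) (snd w) I).

(* g is C^1 on the open set W of R^2, with partial derivatives gu and gv. *)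
Definition is_C1_on (W : R * R -> Prop) (g gu gv : R * R -> H) : Prop :=
  forall u v : R, W (u, v) ->
    is_derive (fun t : R => g (t, v)) u (gu (u, v)) /\
    is_derive (fun t : R => g (u, t)) v (gv (u, v)) /\
    continuous gu (u, v) /\ continuous gv (u, v).

Definition slice_hyperholomorphic (U : H -> Prop) (f : H -> H) : Prop :=
  exists alpha alpha_u alpha_v beta beta_u beta_v : R * R -> H,
    is_C1_on (slice_domain U) alpha alpha_u alpha_v /\
    is_C1_on (slice_domain U) beta beta_u beta_v /\
    forall u v : R, slice_domain U (u, v) ->
      alpha (u, - v) = alpha (u, v) /\
      beta (u, - v) = (- beta (u, v))%H /\
      alpha_u (u, v) = beta_v (u, v) /\
      alpha_v (u, v) = (- beta_u (u, v))%H /\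
      forall I, sphere I ->
        f (slice_pt u v I) = (alpha (u, v) + I * beta (u, v))%H.

(* [is_Dbar f q l] : the four partial derivatives of f at q exist and
   d0 f - e1 d1 f - e2 d2 f - e3 d3 f = l at q. *)
Definition is_Dbar (f : H -> H) (q l : H) : Prop :=
  exists d0 d1 d2 d3 : H,
    is_derive (fun t => f (mkH t (Him1 q) (Him2 q) (Him3 q))) (Hre q) d0 /\
    is_derive (fun t => f (mkH (Hre q) t (Him2 q) (Him3 q))) (Him1 q) d1 /\
    is_derive (fun t => f (mkH (Hre q) (Him1 q) t (Him3 q))) (Him2 q) d2 /\
    is_derive (fun t => f (mkH (Hre q) (Him1 q) (Him2 q) t)) (Him3 q) d3 /\
    l = (d0 - e1 * d1 - e2 * d2 - e3 * d3)%H.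

(** * The sets Omega(p, R1, R2) *)

(* The outer radius lives in [Rbar], so that it may be infinite. *)
Definition slice_annulus (I p : H) (R1 : R) (R2 : Rbar) (z : H) : Prop :=
  C_slice I z /\ R1 < Hmod (z - p)%H /\ Rbar_lt (Hmod (z - p)%H) R2.

(* The set does not depend on the choice of I in the sphere with p in C_I. *)
Definition Omega_annulus (p : H) (R1 : R) (R2 : Rbar) (q : H) : Prop :=
  exists I, sphere I /\ C_slice I p /\
    exists (x y : R) (J : H), sphere J /\ q = slice_pt x y J /\
      slice_annulus I p R1 R2 (slice_pt x y I) /\
      slice_annulus I p R1 R2 (slice_pt x (- y) I).

(** * Star powers and star products *)

(* (q - p)^{*m}; hence (qbar - p)^{*k} is [star_pow (Hconj q) p k]. *)
Definition star_pow (q p : H) (m : nat) : H :=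
  sum_n (fun i => (Binomial.C m i *: (q ^ i * (- p) ^ (m - i)))%H) m.

(* (q - p)^{*m} * (qbar - p)^{*k}, the outer product being the star product *)
Definition star_pow_mul (q p : H) (m k : nat) : H :=
  sum_n (fun i =>
    sum_n (fun j =>
      ((Binomial.C m i * Binomial.C k j) *:
        (q ^ i * Hconj q ^ j * (- p) ^ (m - i + (k - j))))%H) k) m.

(* (q - p)^{-*n}, meaningful for q outside [p] *)
Definition star_pow_neg (q p : H) (n : nat) : H :=
  (Hinv (q ^ 2 - (2 * Hre p) *: q + RtoH (Hmod p ^ 2)) ^ n
     * star_pow q (Hconj p) n)%H.

Definition Ptilde2 (n : nat) (q p : H) : H :=
  (star_pow q p n +
     (/ INR (n + 1)) *:
       sum_n_m (fun k => star_pow_mul q p (n + 1 - k) (k - 1)) 1 (n + 1))%H.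

(* Used for n >= 1 only. *)
Definition R2poly (n : nat) (q p : H) : H :=
  (INR n *: star_pow (Hconj q) p (n + 1) +
     sum_n_m (fun k => star_pow_mul q p (k + 1) (n - k)) 0 (n - 1))%H.

(* [Qc_inv_pow m p q] is Q_{c,p}^{-m}(q). *)
Definition Qc_inv_pow (m : nat) (p q : H) : H :=
  (Hinv (p ^ 2 - (2 * Hre q) *: p + RtoH (Hmod q ^ 2)) ^ m)%H.

(** * Convergence *)

Definition H_compact (K : H -> Prop) : Prop :=
  forall (T : Type) (V : T -> H -> Prop),
    (forall t, open (V t)) ->
    (forall q, K q -> exists t, V t q) ->
    exists l : list T, forall q, K q -> exists t, In t l /\ V t q.

(* The series with terms u 0, u 1, ... converges to s on A, absolutely at each
   point and uniformly on each compact subset of A. *)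
Definition cv_abs_unif_compact
    (A : H -> Prop) (u : nat -> H -> H) (s : H -> H) : Prop :=
  (forall q, A q -> ex_series (fun n => Hmod (u n q))) /\
  forall K : H -> Prop, H_compact K -> (forall q, K q -> A q) ->
    forall eps : posreal, exists N : nat, forall n : nat, (N <= n)%nat ->
      forall q, K q -> Hmod (sum_n (fun k => u k q) n - s q)%H < eps.

(* x^(1/n) for x >= 0 and n >= 1; [Rpower] alone would send x = 0 to 1. *)
Definition nth_root (n : nat) (x : R) : R :=
  if Rle_dec x 0 then 0 else Rpower x (/ INR n).

(* f is the sum on A of its star-Laurent expansion at p, with coefficients a. *)
Definition star_Laurent_expansion
    (A : H -> Prop) (f : H -> H) (p : H) (a : Z -> H) : Prop :=
  exists g h : H -> H,
    cv_abs_unif_compact A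
      (fun n q => (star_pow q p n * a (Z.of_nat n))%H) g /\
    cv_abs_unif_compact A
      (fun n q => (star_pow_neg q p (S n) * a (- Z.of_nat (S n))%Z)%H) h /\
    forall q, A q -> f q = (g q + h q)%H.

(* Main.v *)
Require Import Defs.
From Stdlib Require Import Reals ZArith Lra Lia.
From Coquelicot Require Import Coquelicot.
Open Scope R_scope.

(* Let [A X = q X - X p], a real-linear operator on the quaternions; then
   (q - p)^{*n} = A^n 1 for n of either sign.  Writing Ab for the operator of
   qbar, A and Ab commute and (A o Ab) X = X (p^2 - 2 q0 p + |q|^2).
   Cauchy-Schwarz bounds |A X| / |X| between the two distances from p to the
   points of [q] in the slice of p, so that the powers of A (resp. of A^{-1})
   are dominated by geometric sequences, uniformly near q.  As A is affine in q,
   A^n - A0^n is the noncommutative derivative sum of the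
   A0^k (A - A0) A0^{n-1-k} up to O(n^2 r^n |q - q0|^2); hence the expansion
   may be differentiated term by term.  Finally
   x - e1 x e1 - e2 x e2 - e3 x e3 = 2 (x + xbar) turns Dbar of A^n into
   2 sum_k (A^k + Ab^k) A^{n-1-k}, which is the polynomial of the theorem, and
   similarly for A^{-n}. *)

(** Uniform convergence of the expansion says nothing about its derivatives in four real variables,
    and operator powers obey no power rule, since an increment does not commute with the operator.
    Hence every estimate carries a factor r^n for a radius r strictly on the right side of R1 or R2:
    the numbers n^2 r^n |a_n| are then summable and dominate both the derived series and the
    quadratic remainders. Both halves follow one scheme. In direction h the operator has derivative
    X |-> s V (h V X), with V = id, s = 1 for A, and V = A^{-1}, s = -1 for A^{-1}. In the sum that
    Dbar produces, the terms without conjugate are all equal; counting them gives the n + 1 in c_n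
    and the leading factor n in [R2poly]. *)

Lemma H_ext (x y : H) :
  Hre x = Hre y -> Him1 x = Him1 y -> Him2 x = Him2 y -> Him3 x = Him3 y ->
  x = y.
Proof.
destruct x as [[[? ?] ?] ?], y as [[[? ?] ?] ?]; cbn.
now intros -> -> -> ->.
Qed.

(** Only variables of type [H] are split into coordinates, which is why compound terms are
    generalized before each call; [clear] keeps unrelated quaternions from being split. *)
Ltac Hcoord_ring :=
  intros;
  repeat match goal with x : H |- _ => destruct x as [[[? ?] ?] ?] end;
  cbv - [Rplus Rmult Ropp Rminus Rinv Rdiv IZR INR Hmod Binomial.C]; ring.

Ltac Hring := intros; apply H_ext; Hcoord_ring.

(** * Perturbation of powers of real-linear operators *)

(** Linearity over the reals only: the operators mix left and right multiplications, so no
    quaternionic linearity is available. *)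
Definition H_linear (G : H -> H) : Prop :=
  (forall X Y, G (X + Y)%H = (G X + G Y)%H) /\
  (forall (s : R) X, G (s *: X)%H = (s *: G X)%H).

Lemma H_linear_minus G X Y : H_linear G -> G (X - Y)%H = (G X - G Y)%H.
Proof.
intros [Ha Hs].
replace (X - Y)%H with (X + (-1) *: Y)%H by Hring.
rewrite Ha, Hs. generalize (G X), (G Y); Hring.
Qed.

Lemma H_linear_iter G n : H_linear G -> H_linear (fun X => Nat.iter n G X).
Proof.
intros [Ha Hs]; split; intros; induction n as [|n IH]; try reflexivity;
  rewrite !Nat.iter_succ, IH; [apply Ha|apply Hs].
Qed.

Definition op_le (r : R) (G : H -> H) : Prop :=
  forall X, norm (G X) <= r * norm X.

Lemma op_le_iter r G n : 0 <= r -> op_le r G -> op_le (r ^ n) (Nat.iter n G).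
Proof.
intros Hr HG X; induction n as [|n IH].
- cbn; lra.
- rewrite Nat.iter_succ; cbn [pow]; eapply Rle_trans; [apply HG|].
  rewrite Rmult_assoc; now apply Rmult_le_compat_l.
Qed.

(* The derivative of [G ^ n] in the direction [D]:
   the sum of the [G ^ k o D o G ^ (n - 1 - k)]. *)
Fixpoint pow_deriv (G D : H -> H) (n : nat) (X : H) : H :=
  match n with
  | 0%nat => RtoH 0
  | S n => (pow_deriv G D n (G X) + Nat.iter n G (D X))%H
  end.

Lemma H_norm_triangle (x y : H) : norm (x + y)%H <= norm x + norm y.
Proof. exact (norm_triangle x y). Qed.

Lemma norm_RtoH0 : norm (RtoH 0) = 0.
Proof. exact norm_zero. Qed.

(** Bounding [D] relative to [r] makes each of the [n] terms at most [C * r ^ n], with no loss of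
    one power of [r]. *)
Lemma pow_deriv_le r C G D n :
  0 <= r -> op_le r G -> op_le (C * r) D ->
  op_le (INR n * C * r ^ n) (pow_deriv G D n).
Proof.
intros Hr HG HD; induction n as [|n IH]; intros X.
- cbn [pow_deriv]. rewrite norm_RtoH0; cbn; lra.
- cbn [pow_deriv]. eapply Rle_trans; [apply H_norm_triangle|].
  assert (Hrn := pow_le r n Hr).
  assert (HX := norm_ge_0 X).
  assert (H1 := op_le_iter r G n Hr HG (D X)).
  assert (H2 : r ^ n * norm (D X) <= r ^ n * (C * r * norm X))
    by (apply Rmult_le_compat_l; [easy|apply HD]).
  assert (H3 := IH (G X)).
  assert (HnC : 0 <= C * r * norm X).
  { eapply Rle_trans; [apply (norm_ge_0 (D X))|apply HD]. }
  assert (H4 : INR n * C * r ^ n * norm (G X) <= INR n * C * r ^ n * (r * norm X)).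
  (* The sign of [C] comes from the bound on [D] at [X] once [r * norm X] is positive; if [G X]
     vanishes, the left side is 0. *)
  { destruct (Rle_lt_or_eq_dec 0 (norm (G X)) (norm_ge_0 _)) as [Hp|<-].
    - apply Rmult_le_compat_l; [|apply HG].
      apply Rmult_le_pos; [|easy]. apply Rmult_le_pos; [apply pos_INR|].
      assert (0 < r * norm X) by (eapply Rlt_le_trans; [apply Hp|apply HG]).
      nra.
    - rewrite Rmult_0_r.
      replace (INR n * C * r ^ n * (r * norm X))
        with (INR n * r ^ n * (C * r * norm X)) by ring.
      apply Rmult_le_pos; [|easy]. apply Rmult_le_pos; [apply pos_INR|easy]. }
  rewrite S_INR; cbn [pow].
  replace ((INR n + 1) * C * (r * r ^ n) * norm X) with
    (INR n * C * r ^ n * (r * norm X) + r ^ n * (C * r * norm X)) by ring.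
  lra.
Qed.

(** Telescoping: G'^(n+1) - G^(n+1) = G'^n (G' - G) + (G'^n - G^n) G. *)
Lemma iter_perturb r eps G G' n :
  0 <= r -> 0 <= eps -> H_linear G' -> op_le r G -> op_le r G' ->
  op_le (eps * r) (fun X => G' X - G X)%H ->
  op_le (INR n * eps * r ^ n) (fun X => Nat.iter n G' X - Nat.iter n G X)%H.
Proof.
intros Hr He HL HG HG' HD; induction n as [|n IH]; intros X.
- cbn [Nat.iter nat_rect]. replace (X - X)%H with (RtoH 0) by Hring.
  rewrite norm_RtoH0; cbn; lra.
- rewrite !Nat.iter_succ_r.
  replace (Nat.iter n G' (G' X) - Nat.iter n G (G X))%H with
    (Nat.iter n G' (G' X - G X) + (Nat.iter n G' (G X) - Nat.iter n G (G X)))%H.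
  2:{ rewrite (H_linear_minus _ _ _ (H_linear_iter G' n HL)).
      generalize (Nat.iter n G' (G' X)), (Nat.iter n G' (G X)),
        (Nat.iter n G (G X)). Hring. }
  eapply Rle_trans; [apply H_norm_triangle|].
  assert (Hrn := pow_le r n Hr).
  assert (H1 := op_le_iter r G' n Hr HG' (G' X - G X)%H).
  assert (H2 : r ^ n * norm (G' X - G X)%H <= r ^ n * (eps * r * norm X))
    by (apply Rmult_le_compat_l; [easy|apply HD]).
  assert (H3 := IH (G X)); cbn beta in H3.
  assert (H4 : INR n * eps * r ^ n * norm (G X) <= INR n * eps * r ^ n * (r * norm X)).
  { apply Rmult_le_compat_l; [|apply HG].
    apply Rmult_le_pos; [|easy]. apply Rmult_le_pos; [apply pos_INR|easy]. }
  rewrite S_INR; cbn [pow].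
  replace ((INR n + 1) * eps * (r * r ^ n) * norm X) with
    (INR n * eps * r ^ n * (r * norm X) + r ^ n * (eps * r * norm X)) by ring.
  lra.
Qed.

(** With E = G' - G, the remainder at n + 1 is the remainder at n applied after G, plus (G'^n - G^n)
    E, which is quadratic in s by [iter_perturb], plus G^n (E - s D). *)
Lemma iter_taylor r C s G G' D n :
  0 <= r -> 0 <= C -> H_linear G -> H_linear G' -> op_le r G -> op_le r G' ->
  op_le (C * Rabs s * r) (fun X => G' X - G X)%H ->
  op_le (C * s ^ 2 * r) (fun X => G' X - G X - s *: D X)%H ->
  op_le (INR n ^ 2 * (C ^ 2 + C) * s ^ 2 * r ^ n)
    (fun X => Nat.iter n G' X - Nat.iter n G X - s *: pow_deriv G D n X)%H.
Proof.
intros Hr HC HL HL' HG HG' HD HD2; induction n as [|n IH]; intros X.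
- cbn [Nat.iter nat_rect pow_deriv].
  replace (X - X - s *: RtoH 0)%H with (RtoH 0) by Hring.
  rewrite norm_RtoH0; cbn; lra.
- rewrite !Nat.iter_succ_r; cbn [pow_deriv].
  set (E := (G' X - G X)%H).
  replace (Nat.iter n G' (G' X) - Nat.iter n G (G X) -
      s *: (pow_deriv G D n (G X) + Nat.iter n G (D X)))%H with
    ((Nat.iter n G' (G X) - Nat.iter n G (G X) - s *: pow_deriv G D n (G X))
     + (Nat.iter n G' E - Nat.iter n G E) + Nat.iter n G (E - s *: D X))%H.
  2:{ assert (HLn := H_linear_iter G n HL). unfold E.
      rewrite (H_linear_minus _ _ _ (H_linear_iter G' n HL')).
      rewrite !(H_linear_minus _ _ _ HLn).
      rewrite (proj2 HLn).
      generalize (Nat.iter n G' (G' X)), (Nat.iter n G' (G X)),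
        (Nat.iter n G (G X)), (Nat.iter n G (G' X)), (Nat.iter n G (D X)),
        (pow_deriv G D n (G X)). Hring. }
  eapply Rle_trans; [apply H_norm_triangle|].
  eapply Rle_trans; [apply Rplus_le_compat_r, H_norm_triangle|].
  assert (Hrn := pow_le r n Hr).
  assert (Hn := pos_INR n). assert (HX := norm_ge_0 X).
  assert (Hs := Rabs_pos s).
  assert (Hs2 : Rabs s * Rabs s = s ^ 2).
  { rewrite <- Rabs_mult, Rabs_pos_eq; [ring|apply Rle_0_sqr]. }
  assert (H1 := op_le_iter r G n Hr HG (E - s *: D X)%H).
  assert (H2 : r ^ n * norm (E - s *: D X)%H <= r ^ n * (C * s ^ 2 * r * norm X))
    by (apply Rmult_le_compat_l; [easy|apply HD2]).
  assert (H3 := IH (G X)); cbn beta in H3.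
  assert (H4 : INR n ^ 2 * (C ^ 2 + C) * s ^ 2 * r ^ n * norm (G X) <=
               INR n ^ 2 * (C ^ 2 + C) * s ^ 2 * r ^ n * (r * norm X)).
  { apply Rmult_le_compat_l; [|apply HG].
    apply Rmult_le_pos; [|easy]. apply Rmult_le_pos; [|apply pow2_ge_0].
    apply Rmult_le_pos; [apply pow2_ge_0|]. assert (H' := pow2_ge_0 C); lra. }
  assert (H5 := iter_perturb r (C * Rabs s) G G' n Hr
    (Rmult_le_pos _ _ HC Hs) HL' HG HG' HD E); cbn beta in H5.
  assert (H6 : INR n * (C * Rabs s) * r ^ n * norm E <=
               INR n * (C * Rabs s) * r ^ n * (C * Rabs s * r * norm X)).
  { apply Rmult_le_compat_l; [|apply HD].
    repeat apply Rmult_le_pos; easy. }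
  replace (INR n * (C * Rabs s) * r ^ n * (C * Rabs s * r * norm X)) with
    (INR n * C ^ 2 * (Rabs s * Rabs s) * r ^ n * r * norm X) in H6 by ring.
  rewrite Hs2 in H6.
  rewrite S_INR; cbn [pow].
  (* With K = C^2 + C, the three bounds add up to n^2 K + n C^2 + C, which is at most (n + 1)^2 K,
     times s^2 r^(n+1) |X|. *)
  assert (H7 : 0 <= s ^ 2 * r ^ n * r * norm X).
  { apply Rmult_le_pos; [|easy]. apply Rmult_le_pos; [|easy].
    apply Rmult_le_pos; [apply pow2_ge_0|easy]. }
  assert (H8 : 0 <= INR n * C * (s ^ 2 * r ^ n * r * norm X)).
  { apply Rmult_le_pos; [now apply Rmult_le_pos|easy]. }
  assert (H9 : 0 <= INR n * C ^ 2 * (s ^ 2 * r ^ n * r * norm X)).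
  { apply Rmult_le_pos; [|easy]. apply Rmult_le_pos; [easy|apply pow2_ge_0]. }
  assert (H10 : 0 <= C ^ 2 * (s ^ 2 * r ^ n * r * norm X)).
  { apply Rmult_le_pos; [apply pow2_ge_0|easy]. }
  nra.
Qed.

(** * Termwise differentiation *)

Lemma is_series_H (u : nat -> H) (l0 l1 l2 l3 : R) :
  is_series (fun n => Hre (u n)) l0 -> is_series (fun n => Him1 (u n)) l1 ->
  is_series (fun n => Him2 (u n)) l2 -> is_series (fun n => Him3 (u n)) l3 ->
  is_series u (mkH l0 l1 l2 l3).
Proof.
intros H0 H1 H2 H3.
assert (HS : forall n, sum_n u n = mkH (sum_n (fun k => Hre (u k)) n)
  (sum_n (fun k => Him1 (u k)) n) (sum_n (fun k => Him2 (u k)) n)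
  (sum_n (fun k => Him3 (u k)) n)).
{ induction n as [|n IH].
  - rewrite !sum_O. destruct (u 0%nat) as [[[? ?] ?] ?]; reflexivity.
  - rewrite !sum_Sn, IH. destruct (u (S n)) as [[[? ?] ?] ?]; reflexivity. }
apply filterlim_locally; intros eps.
assert (K0 := proj1 (filterlim_locally _ _) H0 eps).
assert (K1 := proj1 (filterlim_locally _ _) H1 eps).
assert (K2 := proj1 (filterlim_locally _ _) H2 eps).
assert (K3 := proj1 (filterlim_locally _ _) H3 eps).
generalize (filter_and _ _ (filter_and _ _ K0 K1) (filter_and _ _ K2 K3)).
apply filter_imp; intros n [[? ?] [? ?]].
rewrite HS. repeat split; assumption.
Qed.

Lemma Hcomp_le_norm (x : H) :
  Rabs (Hre x) <= norm x /\ Rabs (Him1 x) <= norm x /\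
  Rabs (Him2 x) <= norm x /\ Rabs (Him3 x) <= norm x.
Proof.
rewrite norm_HE; unfold Hmod.
repeat split; rewrite <- sqrt_Rsqr_abs; apply sqrt_le_1_alt; unfold Rsqr; nra.
Qed.

(** The comparison test is applied to the four real coordinates, where completeness is at hand. *)
Lemma ex_series_H_le (u : nat -> H) (k : nat -> R) :
  (forall n, norm (u n) <= k n) -> ex_series k -> exists l, is_series u l.
Proof.
intros Hu Hk.
assert (HC : forall pr : H -> R, (forall x, Rabs (pr x) <= norm x) ->
  exists l : R, is_series (fun n => pr (u n)) l).
{ intros pr Hpr. apply (@ex_series_le R_AbsRing R_CompleteNormedModule) with k; [|easy].
  intros n; eapply Rle_trans; [apply Hpr|apply Hu]. }
destruct (HC Hre) as [l0 H0]; [apply Hcomp_le_norm|].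
destruct (HC Him1) as [l1 H1]; [apply Hcomp_le_norm|].
destruct (HC Him2) as [l2 H2]; [apply Hcomp_le_norm|].
destruct (HC Him3) as [l3 H3]; [apply Hcomp_le_norm|].
eexists; apply is_series_H; eassumption.
Qed.

Lemma is_series_norm_le (u : nat -> H) (k : nat -> R) (l : H) (m : R) :
  (forall n, norm (u n) <= k n) -> is_series u l -> is_series k m ->
  norm l <= m.
Proof.
intros Hu Hl Hm.
assert (L1 : is_lim_seq (fun n => norm (sum_n u n)) (norm l)).
{ apply (filterlim_comp _ _ _ (sum_n u) norm eventually (locally l) _ Hl).
  apply filterlim_norm. }
assert (L2 : is_lim_seq (sum_n k) m) by exact Hm.
refine (is_lim_seq_le _ _ (Finite _) (Finite _) _ L1 L2); intros n.
eapply Rle_trans; [apply norm_sum_n_m|]. now apply sum_n_m_le.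
Qed.

Lemma is_derive_of_quadratic (V : NormedModule R_AbsRing) (phi : R -> V) (t0 : R) (d : V)
    (delta : posreal) (K : R) :
  (forall t, Rabs (t - t0) < delta ->
     norm (minus (minus (phi t) (phi t0)) (scal (t - t0) d)) <= K * (t - t0) ^ 2) ->
  is_derive phi t0 d.
Proof.
intros HK; split; [apply is_linear_scal_l|].
intros x Hx eps.
rewrite <- (is_filter_lim_locally_unique _ _ Hx); clear x Hx.
(* Adding 1 to [Rabs K] keeps the denominator positive even for [K = 0]. *)
assert (Hp : 0 < Rmin delta (eps / (Rabs K + 1))).
{ apply Rmin_pos; [apply cond_pos|].
  apply Rdiv_lt_0_compat; [apply cond_pos|]. assert (H := Rabs_pos K); lra. }
exists (mkposreal _ Hp); intros t Ht.
change (Rabs (t - t0) < Rmin delta (eps / (Rabs K + 1))) in Ht.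
assert (Ht1 := Rlt_le_trans _ _ _ Ht (Rmin_l _ _)).
assert (Ht2 := Rlt_le_trans _ _ _ Ht (Rmin_r _ _)).
eapply Rle_trans; [now apply HK|].
change (norm (minus t t0)) with (Rabs (t - t0)).
assert (Hs : (t - t0) ^ 2 = Rabs (t - t0) * Rabs (t - t0)).
{ rewrite <- Rabs_mult, Rabs_pos_eq; [ring|apply Rle_0_sqr]. }
rewrite Hs, <- Rmult_assoc.
apply Rmult_le_compat_r; [apply Rabs_pos|].
assert (HKp := Rabs_pos K). assert (HK1 := Rle_abs K).
apply Rle_trans with ((Rabs K + 1) * Rabs (t - t0)).
- apply Rmult_le_compat_r; [apply Rabs_pos|lra].
- apply Rlt_le in Ht2. apply Rmult_le_compat_l with (r := Rabs K + 1) in Ht2; [|lra].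
  replace ((Rabs K + 1) * (eps / (Rabs K + 1))) with (pos eps) in Ht2; [easy|].
  field; lra.
Qed.

(** Euler's four-square identity under the root. *)
Lemma norm_mult (x y : H) : norm (x * y)%H = norm x * norm y.
Proof.
rewrite !norm_HE; unfold Hmod.
rewrite <- sqrt_mult_alt by nra; f_equal.
Hcoord_ring.
Qed.

Lemma norm_Hscal (s : R) (x : H) : norm (s *: x)%H = Rabs s * norm x.
Proof.
replace (s *: x)%H with (RtoH s * x)%H by Hring.
rewrite norm_mult; f_equal.
rewrite norm_HE; unfold Hmod; rewrite <- sqrt_Rsqr_abs; f_equal.
cbn; unfold Rsqr; ring.
Qed.

Lemma norm_Hopp (x : H) : norm (- x)%H = norm x.
Proof. exact (norm_opp x). Qed.

Lemma norm_basis :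
  norm Hone = 1 /\ norm e1 = 1 /\ norm e2 = 1 /\ norm e3 = 1.
Proof.
repeat split; rewrite norm_HE; unfold Hmod; rewrite <- sqrt_1; f_equal; Hcoord_ring.
Qed.

(** One summable sequence controls everything: n r^n |b_n| bounds the derived series and n^2 r^n
    |b_n| the second-order remainders, both up to constants. Powers start at [S n] because the power
    0 is constant in [t]. *)
Lemma op_series_derive (G : R -> H -> H) (D : H -> H) (t0 r C : R)
    (delta : posreal) (b : nat -> H) (phi : R -> H) :
  0 <= r -> 0 <= C ->
  (forall t, Rabs (t - t0) < delta ->
     H_linear (G t) /\ op_le r (G t) /\
     op_le (C * Rabs (t - t0) * r) (fun X => G t X - G t0 X)%H /\
     op_le (C * (t - t0) ^ 2 * r)
       (fun X => G t X - G t0 X - (t - t0) *: D X)%H /\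
     is_series (fun n => Nat.iter (S n) (G t) Hone * b n)%H (phi t)) ->
  op_le (C * r) D ->
  ex_series (fun n => INR (S n) ^ 2 * r ^ S n * norm (b n)) ->
  exists d : H,
    is_series (fun n => pow_deriv (G t0) D (S n) Hone * b n)%H d /\
    is_derive phi t0 d.
Proof.
intros Hr HC HG HD [m Hm].
assert (H00 : Rabs (t0 - t0) < delta)
  by (unfold Rminus; rewrite Rplus_opp_r, Rabs_R0; apply cond_pos).
destruct (HG t0 H00) as (HL0 & HG0 & _ & _ & HS0).
destruct (ex_series_H_le (fun n => pow_deriv (G t0) D (S n) Hone * b n)%H
  (fun n => C * (INR (S n) ^ 2 * r ^ S n * norm (b n)))) as [d Hd].
{ intros n. rewrite norm_mult.
  assert (H1 := pow_deriv_le r C (G t0) D (S n) Hr HG0 HD Hone).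
  rewrite (proj1 norm_basis), Rmult_1_r in H1.
  assert (Hrn := pow_le r (S n) Hr).
  assert (Hn : 1 <= INR (S n)) by (rewrite S_INR; assert (H2 := pos_INR n); lra).
  rewrite <- !Rmult_assoc. apply Rmult_le_compat_r; [apply norm_ge_0|].
  eapply Rle_trans; [exact H1|].
  apply Rmult_le_compat_r; [easy|]. rewrite (Rmult_comm _ C).
  apply Rmult_le_compat_l; [easy|nra]. }
{ exists (scal C m). apply (is_series_scal C _ _ Hm). }
exists d; split; [exact Hd|].
(* The constant is the sum over n of the remainder bounds of [iter_taylor]. *)
apply is_derive_of_quadratic with delta ((C ^ 2 + C) * m).
intros t Ht; destruct (HG t Ht) as (HL & HGt & HG1 & HG2 & HS).
apply is_series_norm_le with
  (u := fun n => (Nat.iter (S n) (G t) Hone * b n - Nat.iter (S n) (G t0) Hone * b n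
     - (t - t0) *: (pow_deriv (G t0) D (S n) Hone * b n))%H)
  (k := fun n => (C ^ 2 + C) * (t - t0) ^ 2 * (INR (S n) ^ 2 * r ^ S n * norm (b n))).
- intros n.
  replace (Nat.iter (S n) (G t) Hone * b n - Nat.iter (S n) (G t0) Hone * b n
     - (t - t0) *: (pow_deriv (G t0) D (S n) Hone * b n))%H with
    ((Nat.iter (S n) (G t) Hone - Nat.iter (S n) (G t0) Hone
     - (t - t0) *: pow_deriv (G t0) D (S n) Hone) * b n)%H
    by (generalize (Nat.iter (S n) (G t) Hone), (Nat.iter (S n) (G t0) Hone),
          (pow_deriv (G t0) D (S n) Hone), (b n); Hring).
  rewrite norm_mult, <- !Rmult_assoc.
  apply Rmult_le_compat_r; [apply norm_ge_0|].
  assert (H1 := iter_taylor r C (t - t0) (G t0) (G t) D (S n)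
    Hr HC HL0 HL HG0 HGt HG1 HG2 Hone).
  cbn beta in H1. rewrite (proj1 norm_basis), Rmult_1_r in H1.
  eapply Rle_trans; [exact H1|]. apply Req_le; ring.
- exact (is_series_minus _ _ _ _ (is_series_minus _ _ _ _ HS HS0)
    (is_series_scal (V := H_NormedModule) (t - t0) _ _ Hd)).
- replace ((C ^ 2 + C) * m * (t - t0) ^ 2) with
    (scal ((C ^ 2 + C) * (t - t0) ^ 2) m)
    by (unfold scal; cbn; unfold mult; cbn; ring).
  apply (is_series_scal _ _ _ Hm).
Qed.

(** * The operator Dbar on powers *)

(* [G] is a polynomial in left multiplication by [q] with right coefficients,
   [Gb] the same polynomial in left multiplication by [Hconj q]; one coefficient
   besides the constant one suffices as [q ^ 2] is a real combination of
   [q] and [1], with coefficients invariant under conjugation. *)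
Definition conj_pair (q : H) (G Gb : H -> H) : Prop :=
  exists r1 r2 : H, forall X,
    G X = (X * r1 + q * X * r2)%H /\ Gb X = (X * r1 + Hconj q * X * r2)%H.

Lemma conj_pair_id q : conj_pair q (fun X => X) (fun X => X).
Proof. exists Hone, (RtoH 0); split; Hring. Qed.

(** [q] and [Hconj q] are roots of the same real quadratic x^2 = 2 q0 x - |q|^2, so the same
    coefficients reduce both composites. *)
Lemma conj_pair_comp q G Gb F Fb :
  conj_pair q G Gb -> conj_pair q F Fb ->
  conj_pair q (fun X => G (F X)) (fun X => Gb (Fb X)).
Proof.
intros (r1 & r2 & HG) (s1 & s2 & HF).
exists (s1 * r1 - (Hre q ^ 2 + Him1 q ^ 2 + Him2 q ^ 2 + Him3 q ^ 2) *: (s2 * r2))%H,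
  (s2 * r1 + s1 * r2 + (2 * Hre q) *: (s2 * r2))%H.
intros X; split.
- rewrite (proj1 (HF X)), (proj1 (HG _)).
  replace (q * (X * s1 + q * X * s2) * r2)%H with
    (q * (X * (s1 * r2)) + (q * q) * (X * (s2 * r2)))%H
    by (clear; Hring).
  replace (q * q)%H with ((2 * Hre q) *: q -
    RtoH (Hre q ^ 2 + Him1 q ^ 2 + Him2 q ^ 2 + Him3 q ^ 2))%H by (clear; Hring).
  set (n := Hre q ^ 2 + Him1 q ^ 2 + Him2 q ^ 2 + Him3 q ^ 2); clearbody n.
  set (u := Hre q); clearbody u; clear. Hring.
- rewrite (proj2 (HF X)), (proj2 (HG _)).
  replace (Hconj q * (X * s1 + Hconj q * X * s2) * r2)%H with
    (Hconj q * (X * (s1 * r2)) + (Hconj q * Hconj q) * (X * (s2 * r2)))%H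
    by (clear; generalize (Hconj q); Hring).
  replace (Hconj q * Hconj q)%H with ((2 * Hre q) *: Hconj q -
    RtoH (Hre q ^ 2 + Him1 q ^ 2 + Him2 q ^ 2 + Him3 q ^ 2))%H by (clear; Hring).
  set (n := Hre q ^ 2 + Him1 q ^ 2 + Him2 q ^ 2 + Him3 q ^ 2); clearbody n.
  set (u := Hre q); clearbody u; generalize (Hconj q); clear. Hring.
Qed.

Lemma conj_pair_iter q G Gb n :
  conj_pair q G Gb -> conj_pair q (Nat.iter n G) (Nat.iter n Gb).
Proof.
intros HG; induction n as [|n IH]; [apply conj_pair_id|].
exact (conj_pair_comp _ _ _ _ _ HG IH).
Qed.

(* [x - e1 x e1 - e2 x e2 - e3 x e3 = 2 (x + Hconj x)], applied to [x = q]. *)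
Lemma conj_pair_Dbar q G Gb X :
  conj_pair q G Gb ->
  (G X - e1 * G (e1 * X) - e2 * G (e2 * X) - e3 * G (e3 * X))%H =
  (2 *: (G X + Gb X))%H.
Proof.
intros (r1 & r2 & HG).
rewrite !(fun X => proj1 (HG X)), (proj2 (HG X)). clear HG. revert q X r1 r2.
Hring.
Qed.

Lemma conj_pair_linear q G Gb : conj_pair q G Gb -> H_linear G.
Proof.
intros (r1 & r2 & HG); split; intros; rewrite !(fun X => proj1 (HG X));
  clear HG; revert q r1 r2; Hring.
Qed.

(** In a term G^k V (e (V G^(m-k) X)) the unit [e] stands directly below the operator G^k V, which
    belongs to a conjugate pair; [conj_pair_Dbar] then sums over the four units. *)
Lemma pow_deriv_Dbar q G Gb V Vb (s : R) m X :
  conj_pair q G Gb -> conj_pair q V Vb ->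
  let D e := fun Y => (s *: V (e * V Y))%H in
  (pow_deriv G (D Hone) (S m) X - e1 * pow_deriv G (D e1) (S m) X
   - e2 * pow_deriv G (D e2) (S m) X - e3 * pow_deriv G (D e3) (S m) X)%H =
  ((2 * s) *: sum_n (fun k =>
     Nat.iter k G (V (V (Nat.iter (m - k) G X))) +
     Nat.iter k Gb (Vb (V (Nat.iter (m - k) G X)))) m)%H.
Proof.
intros HG HV D.
assert (HT : forall n Y, (Nat.iter n G (D Hone Y) - e1 * Nat.iter n G (D e1 Y)
  - e2 * Nat.iter n G (D e2 Y) - e3 * Nat.iter n G (D e3 Y))%H =
  ((2 * s) *: (Nat.iter n G (V (V Y)) + Nat.iter n Gb (Vb (V Y))))%H).
{ intros n Y.
  assert (HP := conj_pair_comp _ _ _ _ _ (conj_pair_iter q G Gb n HG) HV).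
  assert (HL := conj_pair_linear _ _ _ (conj_pair_iter q G Gb n HG)).
  assert (HE := conj_pair_Dbar _ _ _ (V Y) HP); cbn beta in HE.
  unfold D. rewrite !(proj2 HL).
  replace (Hone * V Y)%H with (V Y) by (generalize (V Y); Hring).
  replace ((2 * s) *: (Nat.iter n G (V (V Y)) + Nat.iter n Gb (Vb (V Y))))%H with
    (s *: (2 *: (Nat.iter n G (V (V Y)) + Nat.iter n Gb (Vb (V Y)))))%H
   by (generalize (Nat.iter n G (V (V Y))), (Nat.iter n Gb (Vb (V Y))); Hring).
  rewrite <- HE.
  generalize (Nat.iter n G (V (V Y))), (Nat.iter n G (V (e1 * V Y))%H),
    (Nat.iter n G (V (e2 * V Y))%H), (Nat.iter n G (V (e3 * V Y))%H). Hring. }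
revert X; induction m as [|m IH]; intros X.
- rewrite sum_O. cbn [pow_deriv]. assert (H1 := HT 0%nat X).
  cbn [Nat.iter nat_rect Nat.sub] in *. rewrite <- H1.
  generalize (D Hone X), (D e1 X), (D e2 X), (D e3 X). Hring.
(* The last summand has inner power 0; the others absorb one [G] into the argument, where the
   induction hypothesis applies. *)
- rewrite sum_Sn, Nat.sub_diag.
  rewrite (sum_n_ext_loc _ (fun k =>
     Nat.iter k G (V (V (Nat.iter (m - k) G (G X)))) +
     Nat.iter k Gb (Vb (V (Nat.iter (m - k) G (G X)))))%H).
  2:{ intros k Hk. rewrite Nat.sub_succ_l by lia. now rewrite Nat.iter_succ_r. }
  specialize (IH (G X)). specialize (HT (S m) X).
  cbn beta. change (Nat.iter 0 G X) with X.
  set (Sg := sum_n _ m) in *.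
  match goal with |- _ = (_ *: (_ + ?z))%H => set (Z := z) in * end.
  replace ((2 * s) *: (Sg + Z))%H with ((2 * s) *: Sg + (2 * s) *: Z)%H
    by (generalize Sg, Z; Hring).
  rewrite <- IH, <- HT.
  remember (S m) as m' eqn:Em. cbn [pow_deriv]. subst m'.
  generalize (pow_deriv G (D Hone) (S m) (G X)), (pow_deriv G (D e1) (S m) (G X)),
    (pow_deriv G (D e2) (S m) (G X)), (pow_deriv G (D e3) (S m) (G X)),
    (Nat.iter (S m) G (D Hone X)), (Nat.iter (S m) G (D e1 X)),
    (Nat.iter (S m) G (D e2 X)), (Nat.iter (S m) G (D e3 X)).
  Hring.
Qed.

(** * Star powers as operator powers *)

Definition star_op (q p X : H) : H := (q * X - X * p)%H.

Lemma star_op_linear q p : H_linear (star_op q p).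
Proof. unfold star_op; split; Hring. Qed.

Lemma star_op_comm q p X :
  star_op q p (star_op (Hconj q) p X) = star_op (Hconj q) p (star_op q p X).
Proof. unfold star_op; revert q p X; Hring. Qed.

Lemma H_linear_sum_n G (u : nat -> H) n :
  H_linear G -> G (sum_n u n) = sum_n (fun k => G (u k)) n.
Proof.
intros [Ha _]; induction n as [|n IH].
- now rewrite !sum_O.
- rewrite !sum_Sn. rewrite <- IH. apply Ha.
Qed.

Lemma binom_0 n : Binomial.C n 0 = 1.
Proof.
unfold Binomial.C; rewrite Nat.sub_0_r; cbn [fact INR].
rewrite Rmult_1_l; apply Rinv_r, INR_fact_neq_0.
Qed.

Lemma binom_diag n : Binomial.C n n = 1.
Proof.
unfold Binomial.C; rewrite Nat.sub_diag; cbn [fact INR].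
rewrite Rmult_1_r; apply Rinv_r, INR_fact_neq_0.
Qed.

Lemma Hscal_plus (a b : R) (x : H) : ((a + b)%R *: x = a *: x + b *: x)%H.
Proof. revert x; Hring. Qed.

(** Pascal's rule summed. The top term is treated apart: [Binomial.C m (S m)] is not 0 but 1 / (m +
    1), by truncated subtraction, so the first sum on the right must stop at [m]. *)
Lemma sum_n_pascal (u : nat -> H) m :
  sum_n (fun i => Binomial.C (S m) i *: u i)%H (S m) =
  (sum_n (fun i => Binomial.C m i *: u i) m +
   sum_n (fun i => Binomial.C m i *: u (S i)) m)%H.
Proof.
assert (HP : forall j, (j < m)%nat ->
  sum_n (fun i => Binomial.C (S m) i *: u i)%H (S j) =
  (sum_n (fun i => Binomial.C m i *: u i) (S j) +
   sum_n (fun i => Binomial.C m i *: u (S i)) j)%H).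
{ induction j as [|j IH]; intros Hj.
  - rewrite !sum_Sn, !sum_O, !binom_0, <- pascal, binom_0 by easy.
    rewrite Hscal_plus. generalize (u 0%nat), (u 1%nat). Hring.
  - rewrite (sum_Sn _ (S j)), IH, <- pascal, Hscal_plus by lia.
    rewrite (sum_Sn _ (S j)), (sum_Sn (fun i => (Binomial.C m i *: u (S i))%H) j).
    generalize (sum_n (fun i => Binomial.C m i *: u i)%H (S j)),
      (sum_n (fun i => Binomial.C m i *: u (S i))%H j),
      (Binomial.C m (S j) *: u (S (S j)))%H,
      (Binomial.C m (S (S j)) *: u (S (S j)))%H. Hring. }
destruct m as [|j].
- rewrite sum_Sn, !sum_O, !binom_0, binom_diag. reflexivity.
- rewrite sum_Sn, HP, !binom_diag by lia.
  rewrite (sum_Sn (fun i => (Binomial.C (S j) i *: u (S i))%H) j), binom_diag.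
  generalize (sum_n (fun i => Binomial.C (S j) i *: u i)%H (S j)),
      (sum_n (fun i => Binomial.C (S j) i *: u (S i))%H j),
      (u (S (S j))). Hring.
Qed.

Lemma Hmul_1_r (x : H) : (x * Hone)%H = x.
Proof. revert x; Hring. Qed.

Lemma Hmul_1_l (x : H) : (Hone * x)%H = x.
Proof. revert x; Hring. Qed.

Lemma pow_S (x : H) n : (x ^ S n)%H = (x ^ n * x)%H.
Proof.
change (x ^ S n)%H with (x * x ^ n)%H. symmetry. apply (pow_n_comm_1 (K := H_Ring)).
Qed.

(** The binomial theorem for two commuting operators, left multiplication by [q] and right
    multiplication by [- p]. *)
Lemma iter_star_op q p m X :
  Nat.iter m (star_op q p) X =
  sum_n (fun i => Binomial.C m i *: (q ^ i * X * (- p) ^ (m - i)))%H m.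
Proof.
induction m as [|m IH].
- rewrite sum_O, binom_0. cbn. revert X; Hring.
- rewrite Nat.iter_succ, IH, (H_linear_sum_n _ _ _ (star_op_linear q p)).
  rewrite (sum_n_pascal (fun i => q ^ i * X * (- p) ^ (S m - i))%H).
  rewrite (sum_n_ext_loc
    (fun i => Binomial.C m i *: (q ^ i * X * (- p) ^ (S m - i)))%H
    (fun i => Binomial.C m i *: ((q ^ i * X * (- p) ^ (m - i)) * (- p)))%H).
  2:{ intros i Hi. rewrite Nat.sub_succ_l by lia. rewrite pow_S.
      now rewrite (mult_assoc (K := H_Ring)). }
  rewrite <- (sum_n_plus (G := H_AbelianMonoid)).
  apply sum_n_ext; intros i. unfold star_op.
  change (S m - S i)%nat with (m - i)%nat.
  change (q ^ S i)%H with (q * q ^ i)%H.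
  generalize (Binomial.C m i), (q ^ i)%H, ((- p) ^ (m - i))%H; intros c Y Z.
  replace (q * Y * X * Z)%H with (q * (Y * X * Z))%H
    by now rewrite !(mult_assoc (K := H_Ring)).
  generalize (Y * X * Z)%H; clear IH; revert c q p; Hring.
Qed.

Lemma star_powE q p m : star_pow q p m = Nat.iter m (star_op q p) Hone.
Proof.
rewrite iter_star_op. apply sum_n_ext; intros i.
now rewrite Hmul_1_r.
Qed.

Lemma star_pow_mulE q p m k :
  star_pow_mul q p m k =
  Nat.iter m (star_op q p) (Nat.iter k (star_op (Hconj q) p) Hone).
Proof.
rewrite (iter_star_op q), (iter_star_op (Hconj q)).
apply sum_n_ext; intros i.
assert (HL : H_linear (fun Y => Binomial.C m i *: (q ^ i * Y * (- p) ^ (m - i)))%H).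
{ generalize (Binomial.C m i), (q ^ i)%H, ((- p) ^ (m - i))%H; clear.
  intros c A B; split; Hring. }
rewrite (H_linear_sum_n _ _ _ HL).
apply sum_n_ext; intros j.
replace (m - i + (k - j))%nat with (k - j + (m - i))%nat by lia.
rewrite (pow_n_plus (K := H_Ring)).
rewrite Hmul_1_r.
generalize (Binomial.C m i), (Binomial.C k j), (q ^ i)%H, (Hconj q ^ j)%H,
  ((- p) ^ (k - j))%H, ((- p) ^ (m - i))%H; clear; intros c d A B V U.
replace (A * (d *: (B * V)))%H with (d *: (A * (B * V)))%H
  by (generalize (B * V)%H; Hring).
replace (c *: (d *: (A * (B * V)) * U))%H with ((c * d) *: (A * (B * V) * U))%H
  by (generalize (A * (B * V))%H; Hring).
now rewrite !(mult_assoc (K := H_Ring)).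
Qed.

(** * Negative star powers as powers of the inverse operator *)

Lemma iter_mul_l (F : H -> H) (v : H) n X :
  (forall Y, F (v * Y)%H = (v * F Y)%H) ->
  Nat.iter n (fun Y => v * F Y)%H X = (v ^ n * Nat.iter n F X)%H.
Proof.
intros HF.
assert (HFn : forall k Y, F (v ^ k * Y)%H = (v ^ k * F Y)%H).
{ induction k as [|k IH]; intros Y.
  - change (v ^ 0)%H with Hone.
    replace (Hone * Y)%H with Y by (generalize Y; Hring).
    generalize (F Y); Hring.
  - change (v ^ S k)%H with (v * v ^ k)%H.
    now rewrite <- !(mult_assoc (K := H_Ring)), HF, IH. }
induction n as [|n IH].
- change (v ^ 0)%H with Hone. cbn; revert X; Hring.
- rewrite !Nat.iter_succ, IH, HFn.
  change (v ^ S n)%H with (v * v ^ n)%H.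
  now rewrite (mult_assoc (K := H_Ring)).
Qed.

Lemma iter_mul_r (F : H -> H) (w : H) n X :
  (forall Y, F (Y * w)%H = (F Y * w)%H) ->
  Nat.iter n (fun Y => F Y * w)%H X = (Nat.iter n F X * w ^ n)%H.
Proof.
intros HF.
assert (HFn : forall k Y, F (Y * w ^ k)%H = (F Y * w ^ k)%H).
{ induction k as [|k IH]; intros Y.
  - change (w ^ 0)%H with Hone. now rewrite !Hmul_1_r.
  - now rewrite pow_S, !(mult_assoc (K := H_Ring)), HF, IH. }
induction n as [|n IH].
- change (w ^ 0)%H with Hone. cbn; revert X; Hring.
- rewrite !Nat.iter_succ, IH, HFn, pow_S.
  now rewrite (mult_assoc (K := H_Ring)).
Qed.

Lemma iter_comm (F G : H -> H) m n X :
  (forall Y, F (G Y) = G (F Y)) ->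
  Nat.iter m F (Nat.iter n G X) = Nat.iter n G (Nat.iter m F X).
Proof.
intros HFG.
assert (H1 : forall k Y, F (Nat.iter k G Y) = Nat.iter k G (F Y)).
{ induction k as [|k IH]; intros Y; [easy|].
  now rewrite !Nat.iter_succ, HFG, IH. }
induction m as [|m IH]; [easy|].
now rewrite !Nat.iter_succ, IH, H1.
Qed.

(** [Hinv w] is a real multiple of 2 Re w - w, so it commutes with whatever commutes with [w]. *)
Lemma Hinv_comm (x w : H) : (w * x = x * w)%H -> (Hinv w * x = x * Hinv w)%H.
Proof.
intros Hw; unfold Hinv. set (s := / _); clearbody s.
replace (Hconj w) with (RtoH (2 * Hre w) - w)%H by Hring.
replace ((s *: (RtoH (2 * Hre w) - w)) * x)%H with
  ((s * (2 * Hre w)) *: x - s *: (w * x))%H by (revert s x w Hw; clear; Hring).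
rewrite Hw. set (u := Hre w); clearbody u; clear Hw; revert s x w u; Hring.
Qed.

(** Serves with both orders of arguments: [Qpoly p q] is the base of [Qc_inv_pow], [Qpoly q p] that
    of [star_pow_neg]. *)
Definition Qpoly (p q : H) : H :=
  (p ^ 2 - (2 * Hre q) *: p + RtoH (Hmod q ^ 2))%H.

Definition star_inv (q p X : H) : H :=
  (star_op (Hconj q) p X * Hinv (Qpoly p q))%H.

Lemma Hmod_sq (x : H) :
  Hmod x ^ 2 = Hre x ^ 2 + Him1 x ^ 2 + Him2 x ^ 2 + Him3 x ^ 2.
Proof. unfold Hmod; rewrite <- Rsqr_pow2; apply Rsqr_sqrt; nra. Qed.

Lemma star_op_conj q p X :
  star_op q p (star_op (Hconj q) p X) = (X * Qpoly p q)%H.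
Proof. unfold Qpoly, star_op; rewrite Hmod_sq; revert q p X; Hring. Qed.

Lemma Qpoly_comm p q : (Qpoly p q * p = p * Qpoly p q)%H.
Proof.
unfold Qpoly; set (s := Hmod q ^ 2); set (u := Hre q); clearbody s u.
revert p; Hring.
Qed.

Lemma star_op_mul_r q p w X :
  (w * p = p * w)%H -> star_op q p (X * w)%H = (star_op q p X * w)%H.
Proof.
intros Hw; unfold star_op.
rewrite <- (mult_assoc (K := H_Ring) X w p), Hw.
rewrite (mult_assoc (K := H_Ring) X p w), (mult_assoc (K := H_Ring) q X w).
generalize (q * X)%H, (X * p)%H; revert w Hw; clear; Hring.
Qed.

Lemma star_op_mul_l q p v X :
  (v * q = q * v)%H -> star_op q p (v * X)%H = (v * star_op q p X)%H.
Proof.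
intros Hv; unfold star_op.
rewrite (mult_assoc (K := H_Ring) q v X), <- Hv.
rewrite <- (mult_assoc (K := H_Ring) v q X), <- (mult_assoc (K := H_Ring) v X p).
generalize (q * X)%H, (X * p)%H; revert v Hv; clear; Hring.
Qed.

Lemma Qinv_comm p q : (Hinv (Qpoly p q) * p = p * Hinv (Qpoly p q))%H.
Proof. apply Hinv_comm, Qpoly_comm. Qed.

Definition op_ge (r : R) (G : H -> H) : Prop :=
  forall X, r * norm X <= norm (G X).

Lemma op_ge_inj r G X : 0 < r -> op_ge r G -> G X = RtoH 0 -> X = RtoH 0.
Proof.
intros Hr HG H0. apply (norm_eq_zero (V := H_NormedModule)).
assert (H1 := HG X); rewrite H0, norm_RtoH0 in H1.
assert (H2 := norm_ge_0 X). nra.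
Qed.

Lemma Hminus_eq (x y : H) : (x - y)%H = RtoH 0 -> x = y.
Proof.
intros E. replace x with ((x - y) + y)%H by Hring. rewrite E; Hring.
Qed.

(** X = 1 gives x = y; then commuting with [e1] and [e2] kills the imaginary parts. *)
Lemma central_real (x y : H) :
  (forall X, star_op x y X = RtoH 0) -> x = RtoH (Hre x) /\ y = x.
Proof.
intros Hc.
assert (H0 := Hminus_eq _ _ (Hc Hone)).
assert (Hxy : y = x).
{ transitivity (Hone * y)%H; [Hring|]. rewrite <- H0; Hring. }
subst y; split; [|easy].
assert (H1 := Hminus_eq _ _ (Hc e1)). assert (H2 := Hminus_eq _ _ (Hc e2)).
apply (f_equal Him3) in H2 as H3. apply (f_equal Him2) in H1 as H4.
apply (f_equal Him3) in H1 as H5.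
destruct x as [[[x0 x1] x2] x3].
cbv - [Rplus Rmult Ropp Rminus IZR] in H3, H4, H5.
apply H_ext; cbn; lra.
Qed.

(** If it vanished, [star_op_conj] and injectivity would make [star_op (Hconj q) p] zero. Then
    [Hconj q = p] is real, so [q = p] and [star_op q p] kills 1. *)
Lemma Qpoly_neq0 r q p :
  0 < r -> op_ge r (star_op q p) -> Qpoly p q <> RtoH 0.
Proof.
intros Hr HG HQ.
destruct (central_real (Hconj q) p) as [Hq Hp].
{ intros X; apply (op_ge_inj r (star_op q p)); [easy|easy|].
  rewrite star_op_conj, HQ; revert X; Hring. }
assert (Hqp : q = p).
{ rewrite Hp. transitivity (Hconj (Hconj q)); [Hring|]. rewrite Hq at 1.
  rewrite Hq; Hring. }
assert (H1 : Hone = RtoH 0).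
{ apply (op_ge_inj r (star_op q p)); [easy|easy|]. rewrite Hqp; unfold star_op; Hring. }
apply (f_equal Hre) in H1; cbn in H1; lra.
Qed.

(** [star_pow_neg] has the inverse quadratic in [q] on the left, [star_inv] the one in [p] on the
    right; this identity carries one form into the other. *)
Lemma Qpoly_swap q p X :
  (star_op q (Hconj p) X * Qpoly p q = Qpoly q p * star_op (Hconj q) p X)%H.
Proof.
unfold Qpoly, star_op; rewrite !Hmod_sq; revert q p X; Hring.
Qed.

Lemma Hinv_l (x : H) : x <> RtoH 0 -> (Hinv x * x)%H = Hone.
Proof. intros Hx; rewrite (Hinv_comm x x) by easy; now apply Hmult_inv_r. Qed.

Lemma Hmul_integral (x y : H) : (x * y)%H = RtoH 0 -> y <> RtoH 0 -> x = RtoH 0.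
Proof.
intros H0 Hy. rewrite <- (Hmul_1_r x), <- (Hmult_inv_r y Hy).
rewrite (mult_assoc (K := H_Ring)), H0. generalize (Hinv y); Hring.
Qed.

(** By [Qpoly_swap] a zero would annihilate [star_op q (Hconj p)], so that [q = Hconj p] is real and
    again [q = p]. *)
Lemma Qpoly_neq0_swap r q p :
  0 < r -> op_ge r (star_op q p) -> Qpoly q p <> RtoH 0.
Proof.
intros Hr HG HQ. assert (HQ' := Qpoly_neq0 r q p Hr HG).
destruct (central_real q (Hconj p)) as [Hq Hp].
{ intros X. apply (Hmul_integral _ (Qpoly p q)); [|easy].
  rewrite Qpoly_swap, HQ. generalize (star_op (Hconj q) p X); Hring. }
assert (Hqp : p = q).
{ transitivity (Hconj (Hconj p)); [Hring|]. rewrite Hp, Hq; Hring. }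
assert (H1 : Hone = RtoH 0).
{ apply (op_ge_inj r (star_op q p)); [easy|easy|]. rewrite Hqp; unfold star_op; Hring. }
apply (f_equal Hre) in H1; cbn in H1; lra.
Qed.

Lemma star_op_inv r q p X :
  0 < r -> op_ge r (star_op q p) -> star_op q p (star_inv q p X) = X.
Proof.
intros Hr HG; unfold star_inv.
rewrite star_op_mul_r by apply Qinv_comm.
rewrite star_op_conj, <- (mult_assoc (K := H_Ring)).
rewrite Hmult_inv_r by now apply (Qpoly_neq0 r). apply Hmul_1_r.
Qed.

Lemma star_inv_op r q p X :
  0 < r -> op_ge r (star_op q p) -> star_inv q p (star_op q p X) = X.
Proof.
intros Hr HG; unfold star_inv.
rewrite <- star_op_comm, star_op_conj, <- (mult_assoc (K := H_Ring)).
rewrite Hmult_inv_r by now apply (Qpoly_neq0 r). apply Hmul_1_r.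
Qed.

Lemma star_inv_le r q p :
  0 < r -> op_ge r (star_op q p) -> op_le (/ r) (star_inv q p).
Proof.
intros Hr HG X. assert (H1 := HG (star_inv q p X)).
rewrite (star_op_inv r) in H1 by easy.
apply (Rmult_le_reg_l r); [easy|].
rewrite <- Rmult_assoc, Rinv_r, Rmult_1_l by lra. exact H1.
Qed.

Lemma star_pow_negE r q p n :
  0 < r -> op_ge r (star_op q p) ->
  star_pow_neg q p n = Nat.iter n (star_inv q p) Hone.
Proof.
intros Hr HG.
assert (HQ := Qpoly_neq0 r q p Hr HG). assert (HQ' := Qpoly_neq0_swap r q p Hr HG).
unfold star_pow_neg. change (q ^ 2 - (2 * Hre p) *: q + RtoH (Hmod p ^ 2))%H
  with (Qpoly q p).
rewrite star_powE, <- iter_mul_l.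
2:{ intros Y; apply star_op_mul_l, Qinv_comm. }
induction n as [|n IH]; [easy|].
rewrite !Nat.iter_succ, IH. set (Y := Nat.iter n _ _); clearbody Y. unfold star_inv.
(* Inserting [Qpoly p q] times its inverse on the right creates the left side of [Qpoly_swap]. *)
rewrite <- (Hmul_1_r (Hinv (Qpoly q p) * _)), <- (Hmult_inv_r _ HQ).
rewrite (mult_assoc (K := H_Ring)), <- (mult_assoc (K := H_Ring) (Hinv (Qpoly q p))).
rewrite Qpoly_swap, (mult_assoc (K := H_Ring) (Hinv (Qpoly q p))), Hinv_l by easy.
f_equal. generalize (star_op (Hconj q) p Y); Hring.
Qed.

Lemma conj_pair_star_op q p :
  conj_pair q (star_op q p) (star_op (Hconj q) p).
Proof. exists (- p)%H, Hone; unfold star_op; split; revert X; Hring. Qed.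

(** [Hconj q = 2 q0 - q] turns [star_inv] into a polynomial in left multiplication by [q]. The
    factor [Qpoly p q] depends on [q] only through q0 and |q|, so conjugation leaves it alone. *)
Lemma conj_pair_star_inv q p :
  conj_pair q (star_inv q p) (fun X => star_op q p X * Hinv (Qpoly p q))%H.
Proof.
unfold star_inv; generalize (Hinv (Qpoly p q)); intros w.
exists ((RtoH (2 * Hre q) - p) * w)%H, (- w)%H; unfold star_op.
split; revert q p w X; Hring.
Qed.

(** * From operator sums to the functions of the theorem *)

Lemma sum_n_Hconst (x : H) m : sum_n (fun _ => x) m = (INR (S m) *: x)%H.
Proof.
induction m as [|m IH].
- rewrite sum_O. cbn [INR]. revert x; Hring.
- rewrite sum_Sn, IH, (S_INR (S m)). generalize (INR (S m)); clear IH; revert x; Hring.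
Qed.

(** The first summands are all the m-th star power. Its m + 1 copies and the mixed terms are matched
    by moving the factor m + 1 of [c] against the 1 / (m + 1) of [Ptilde2]. *)
Lemma Ptilde2E q p m (b c : H) :
  c = ((2 * INR (m + 1)) *: b)%H ->
  ((2 * 1) *: sum_n (fun k =>
     Nat.iter k (star_op q p) (Nat.iter (m - k) (star_op q p) Hone) +
     Nat.iter k (star_op (Hconj q) p) (Nat.iter (m - k) (star_op q p) Hone)) m
   * b)%H = (Ptilde2 m q p * c)%H.
Proof.
intros ->; unfold Ptilde2.
rewrite (Nat.add_comm m 1); cbn [Nat.add].
rewrite <- (sum_n_m_S (G := H_AbelianMonoid)). fold (sum_n (G := H_AbelianMonoid)
  (fun k => star_pow_mul q p (S m - S k) (S k - 1)) m).
rewrite (sum_n_plus (G := H_AbelianMonoid)).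
rewrite (sum_n_ext_loc _ (fun _ => star_pow q p m)).
2:{ intros k Hk. rewrite <- Nat.iter_add, star_powE. f_equal; lia. }
rewrite sum_n_Hconst.
rewrite (sum_n_ext_loc (fun k => Nat.iter k (star_op (Hconj q) p) _)
  (fun k => star_pow_mul q p (S m - S k) (S k - 1))).
2:{ intros k Hk. rewrite star_pow_mulE.
    rewrite (iter_comm (star_op q p)) by (intros; apply star_op_comm).
    replace (S k - 1)%nat with k by lia. reflexivity. }
assert (HN : INR (S m) <> 0) by (apply not_0_INR; lia).
change (sum_n_m (fun k => star_pow_mul q p (S m - S k) (S k - 1)) 0 m) with
  (sum_n (fun k => star_pow_mul q p (S m - S k) (S k - 1)) m).
generalize (sum_n (fun k => star_pow_mul q p (S m - S k) (S k - 1)) m),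
  (star_pow q p m). intros S P.
replace P with ((/ INR (Datatypes.S m) * INR (Datatypes.S m)) *: P)%H at 2
  by (rewrite Rinv_l by easy; revert P; Hring).
set (N := INR (Datatypes.S m)) in *.
transitivity ((2 *: (N *: P + S)) * b)%H; [revert P S b N HN; clear; Hring|].
transitivity ((2 * (N * / N)) *: ((N *: P + S) * b))%H;
 [rewrite Rinv_r by easy|]; revert P S b N HN; clear; Hring.
Qed.

(** [J] and [Jb] are star operators followed by right multiplication by w = [Hinv (Qpoly p q)]. As w
    commutes with [p], it passes through them, and every term carries w^(m+2). The unmixed terms are
    m + 1 copies of J^(m+2), hence the factor [INR (S m)]. *)
Lemma R2polyE q p m (b c : H) :
  c = ((-2) *: b)%H ->
  let J := star_inv q p in
  let Jb := fun X => (star_op q p X * Hinv (Qpoly p q))%H in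
  ((2 * -1) *: sum_n (fun k =>
     Nat.iter k J (J (J (Nat.iter (m - k) J Hone))) +
     Nat.iter k Jb (Jb (J (Nat.iter (m - k) J Hone)))) m
   * b)%H = (R2poly (S m) q p * Qc_inv_pow (S m + 1) p q * c)%H.
Proof.
intros -> J Jb; unfold R2poly, Qc_inv_pow.
change (p ^ 2 - (2 * Hre q) *: p + RtoH (Hmod q ^ 2))%H with (Qpoly p q).
set (w := Hinv (Qpoly p q)).
replace (S m + 1)%nat with (S (S m)) by lia.
replace (S m - 1)%nat with m by lia.
assert (HA : forall q' Y, star_op q' p (Y * w)%H = (star_op q' p Y * w)%H)
  by (intros; apply star_op_mul_r, Qinv_comm).
assert (HAn : forall q' n k Y, Nat.iter n (star_op q' p) (Y * w ^ k)%H =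
  (Nat.iter n (star_op q' p) Y * w ^ k)%H).
{ intros q' n k Y. induction n as [|n IH]; [easy|]. rewrite !Nat.iter_succ, IH.
  apply star_op_mul_r. clear. induction k as [|k IH].
  - change (w ^ 0)%H with Hone; now rewrite Hmul_1_l, Hmul_1_r.
  - rewrite pow_S, <- (mult_assoc (K := H_Ring)). unfold w at 2.
    rewrite Qinv_comm; fold w. now rewrite !(mult_assoc (K := H_Ring)), IH. }
assert (HJ : forall n X, Nat.iter n J X = (Nat.iter n (star_op (Hconj q) p) X * w ^ n)%H).
{ intros n X. apply (iter_mul_r (star_op (Hconj q) p) w). apply HA. }
assert (HJb : forall n X, Nat.iter n Jb X = (Nat.iter n (star_op q p) X * w ^ n)%H).
{ intros n X. apply (iter_mul_r (star_op q p) w). apply HA. }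
rewrite (sum_n_plus (G := H_AbelianMonoid)).
rewrite (sum_n_ext_loc _ (fun _ => star_pow (Hconj q) p (S (S m)) * w ^ S (S m))%H).
2:{ intros k Hk. rewrite star_powE, <- HJ.
    change (J (J (Nat.iter (m - k) J Hone))) with (Nat.iter (S (S (m - k))) J Hone).
    rewrite <- Nat.iter_add.
    f_equal; lia. }
rewrite sum_n_Hconst.
rewrite (sum_n_ext_loc (fun k => Nat.iter k Jb _)
  (fun k => star_pow_mul q p (k + 1) (S m - k) * w ^ S (S m))%H).
2:{ intros k Hk.
    change (J (Nat.iter (m - k) J Hone)) with (Nat.iter (S (m - k)) J Hone).
    rewrite <- Nat.iter_succ_r.
    rewrite HJ, HJb, HAn, <- (mult_assoc (K := H_Ring)), <- (pow_n_plus (K := H_Ring)).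
    rewrite star_pow_mulE. f_equal; [|f_equal; lia].
    replace (k + 1)%nat with (S k) by lia. f_equal. f_equal. lia. }
assert (HL : H_linear (fun Y => Y * w ^ S (S m))%H)
  by (generalize (w ^ S (S m))%H; clear; intros z; split; Hring).
rewrite <- (H_linear_sum_n _ (fun k => star_pow_mul q p (k + 1) (S m - k)) _ HL).
change (sum_n_m (fun k => star_pow_mul q p (k + 1) (S m - k)) 0 m) with
  (sum_n (fun k => star_pow_mul q p (k + 1) (S m - k)) m).
generalize (sum_n (fun k => star_pow_mul q p (k + 1) (S m - k)) m),
  (star_pow (Hconj q) p (S (S m))), (w ^ S (S m))%H, (INR (S m)).
intros A B W N.
transitivity ((-2) *: ((N *: B + A) * W * b))%H; [|generalize ((N *: B + A) * W)%H; revert b; clear; Hring].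
replace (N *: (B * W) + A * W)%H with ((N *: B + A) * W)%H by (clear; Hring).
generalize ((N *: B + A) * W)%H; revert b; clear; Hring.
Qed.

(** * Termwise Dbar of the two halves of the expansion *)

Lemma is_series_Hmul_l (e : H) (u : nat -> H) (l : H) :
  is_series u l -> is_series (fun n => e * u n)%H (e * l)%H.
Proof.
intros Hu.
assert (HL : H_linear (fun X => e * X)%H) by (split; Hring).
assert (HC : is_linear (fun X : H => (e * X)%H : H)).
{ split; [exact (proj1 HL)|exact (proj2 HL)|].
  (* A linear map needs a positive bound here, also when [e] is 0. *)
  exists (norm e + 1); split; [assert (H0 := norm_ge_0 e); lra|].
  intros X. rewrite norm_mult. assert (H0 := norm_ge_0 X). nra. }
apply filterlim_ext with (fun n => (e * sum_n u n)%H).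
{ intros n. exact (H_linear_sum_n _ u n HL). }
exact (filterlim_comp _ _ _ (sum_n u) (fun X : H => (e * X)%H : H)
  eventually (locally l) _ Hu (linear_cont _ _ HC)).
Qed.

(** [op_series_derive] along the four coordinate lines, for a family whose first variation is X |->
    s V (h V X); this shape covers both [star_op] and [star_inv]. *)
Lemma op_series_Dbar (G : H -> H -> H) (Gb V Vb : H -> H) (s : R) (q : H)
    (r C : R) (delta : posreal) (b : nat -> H) (phi : H -> H) :
  0 <= r -> 0 <= C ->
  (forall q' : H, norm (q' - q)%H < delta ->
     H_linear (G q') /\ op_le r (G q') /\
     op_le (C * norm (q' - q)%H * r) (fun X => G q' X - G q X)%H /\
     op_le (C * norm (q' - q)%H ^ 2 * r)
       (fun X => G q' X - G q X - s *: V ((q' - q) * V X))%H /\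
     is_series (fun n => Nat.iter (S n) (G q') Hone * b n)%H (phi q')) ->
  (forall h : H, op_le (C * norm h * r) (fun X => s *: V (h * V X))%H) ->
  conj_pair q (G q) Gb -> conj_pair q V Vb ->
  ex_series (fun n => INR (S n) ^ 2 * r ^ S n * norm (b n)) ->
  exists l : H,
    is_series (fun m => (2 * s) *: sum_n (fun k =>
      Nat.iter k (G q) (V (V (Nat.iter (m - k) (G q) Hone))) +
      Nat.iter k Gb (Vb (V (Nat.iter (m - k) (G q) Hone)))) m * b m)%H l /\
    is_Dbar phi q l.
Proof.
intros Hr HC HG HD HP HV Hb.
assert (HVL := conj_pair_linear _ _ _ HV).
set (D e := fun Y => (s *: V (e * V Y))%H).
(* The four coordinate lines are lines through [q] with unit directions [Hone], [e1], [e2], [e3], so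
   one statement treats them all. *)
assert (Hdir : forall (e : H) (gam : R -> H) (t0 : R), norm e = 1 ->
  (forall t, (gam t - q)%H = ((t - t0) *: e)%H) ->
  exists d : H, is_series (fun n => pow_deriv (G q) (D e) (S n) Hone * b n)%H d /\
    is_derive (fun t => phi (gam t)) t0 d).
{ intros e gam t0 He Hgam.
  assert (Hg0 : gam t0 = q).
  { apply Hminus_eq; rewrite Hgam. unfold Rminus; rewrite Rplus_opp_r.
    clear; revert e; Hring. }
  assert (Hn : forall t, norm (gam t - q)%H = Rabs (t - t0)).
  { intros t; rewrite Hgam, norm_Hscal, He; ring. }
  destruct (op_series_derive (fun t => G (gam t)) (D e) t0 r C delta b
    (fun t => phi (gam t))) as (d & S & Dd); try easy.
  - intros t Ht. rewrite <- Hn in Ht. destruct (HG _ Ht) as (H1 & H2 & H3 & H4 & H5).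
    rewrite Hg0. rewrite Hn in H3, H4.
    repeat split; try easy; try apply H1.
    intros X. specialize (H4 X). cbn beta in H4.
    replace ((t - t0) *: D e X)%H with (s *: V ((gam t - q) * V X))%H.
    + eapply Rle_trans; [exact H4|]. rewrite pow2_abs. apply Rle_refl.
    + rewrite Hgam. unfold D.
      replace (((t - t0) *: e) * V X)%H with ((t - t0) *: (e * V X))%H
        by (generalize (V X); revert e He Hgam; clear; intros e _ _; revert e; Hring).
      rewrite (proj2 HVL). generalize (V (e * V X)%H); clear; Hring.
  - intros X. assert (H1 := HD e X). rewrite He, Rmult_1_r in H1. exact H1.
  - exists d; cbn beta in S; rewrite Hg0 in S; now split. }
destruct norm_basis as (N0 & N1 & N2 & N3).
destruct (Hdir Hone (fun t => mkH t (Him1 q) (Him2 q) (Him3 q)) (Hre q) N0)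
  as (d0 & S0 & D0); [clear; revert q; Hring|].
destruct (Hdir e1 (fun t => mkH (Hre q) t (Him2 q) (Him3 q)) (Him1 q) N1)
  as (d1 & S1 & D1); [clear; revert q; Hring|].
destruct (Hdir e2 (fun t => mkH (Hre q) (Him1 q) t (Him3 q)) (Him2 q) N2)
  as (d2 & S2 & D2); [clear; revert q; Hring|].
destruct (Hdir e3 (fun t => mkH (Hre q) (Him1 q) (Him2 q) t) (Him3 q) N3)
  as (d3 & S3 & D3); [clear; revert q; Hring|].
exists (d0 - e1 * d1 - e2 * d2 - e3 * d3)%H; split.
- eapply is_series_ext;
   [|exact (is_series_minus _ _ _ _ (is_series_minus _ _ _ _ (is_series_minus _ _ _ _ S0
      (is_series_Hmul_l e1 _ _ S1)) (is_series_Hmul_l e2 _ _ S2))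
      (is_series_Hmul_l e3 _ _ S3))].
  intros m; cbn beta.
  transitivity ((pow_deriv (G q) (D Hone) (S m) Hone
    - e1 * pow_deriv (G q) (D e1) (S m) Hone
    - e2 * pow_deriv (G q) (D e2) (S m) Hone
    - e3 * pow_deriv (G q) (D e3) (S m) Hone) * b m)%H.
  + generalize (pow_deriv (G q) (D Hone) (S m) Hone),
      (pow_deriv (G q) (D e1) (S m) Hone), (pow_deriv (G q) (D e2) (S m) Hone),
      (pow_deriv (G q) (D e3) (S m) Hone), (b m); clear; Hring.
  + f_equal. exact (pow_deriv_Dbar q (G q) Gb V Vb s m Hone HP HV).
- exists d0, d1, d2, d3; tauto.
Qed.

Lemma star_op_sub q q' p X : (star_op q' p X - star_op q p X)%H = ((q' - q) * X)%H.
Proof. unfold star_op; revert q q' p X; Hring. Qed.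

Lemma star_pow_series_Dbar (q p : H) (r : R) (delta : posreal)
    (b : nat -> H) (phi : H -> H) :
  0 < r ->
  (forall q' : H, norm (q' - q)%H < delta ->
     op_le r (star_op q' p) /\
     is_series (fun n => star_pow q' p (S n) * b n)%H (phi q')) ->
  ex_series (fun n => INR (S n) ^ 2 * r ^ S n * norm (b n)) ->
  exists l : H,
    is_series (fun m => Ptilde2 m q p * ((2 * INR (m + 1)) *: b m))%H l /\
    is_Dbar phi q l.
Proof.
intros Hr Hphi Hb.
assert (Hr' : / r * r = 1) by (apply Rinv_l; lra).
assert (Hrp := Rinv_0_lt_compat _ Hr).
(* [C = / r] because the increment is left multiplication by q' - q, of norm |q' - q| = C |q' - q|
   r; its second-order remainder is 0. *)
destruct (op_series_Dbar (fun q' => star_op q' p) (star_op (Hconj q) p)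
  (fun X => X) (fun X => X) 1 q r (/ r) delta b phi) as (l & Hl & HD).
- lra.
- lra.
- intros q' Hq'; destruct (Hphi q' Hq') as [H1 H2].
  split; [apply star_op_linear|]. split; [easy|].
  split; [|split].
  + intros X; rewrite star_op_sub, norm_mult. apply Req_le.
    rewrite (Rmult_comm (/ r)), (Rmult_assoc _ (/ r)), Hr'; ring.
  + intros X; rewrite star_op_sub.
    replace ((q' - q) * X - 1 *: ((q' - q) * X))%H with (RtoH 0)
      by (generalize ((q' - q) * X)%H; clear; Hring).
    rewrite norm_RtoH0. apply Rmult_le_pos; [|apply norm_ge_0].
    apply Rmult_le_pos; [|lra]. apply Rmult_le_pos; [lra|apply pow2_ge_0].
  + eapply is_series_ext; [|exact H2]; intros n; cbn beta; now rewrite star_powE.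
- intros h X. replace (1 *: (h * X))%H with (h * X)%H by (revert h X; clear; Hring).
  rewrite norm_mult. apply Req_le.
  rewrite (Rmult_comm (/ r)), (Rmult_assoc _ (/ r)), Hr'; ring.
- apply conj_pair_star_op.
- apply conj_pair_id.
- easy.
- exists l; split; [|easy]. eapply is_series_ext; [|exact Hl].
  intros m; cbn beta. now apply Ptilde2E.
Qed.

(** The resolvent identity J' - J = - J' (A' - A) J. *)
Lemma star_inv_sub r q q' p X :
  0 < r -> op_ge r (star_op q p) -> op_ge r (star_op q' p) ->
  (star_inv q' p X - star_inv q p X)%H =
  (- star_inv q' p ((q' - q) * star_inv q p X))%H.
Proof.
intros Hr Hq Hq'.
assert (HL := conj_pair_linear _ _ _ (conj_pair_star_inv q' p)).
assert (HX := star_op_inv r q p X Hr Hq).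
set (Y := star_inv q p X) in *; clearbody Y.
transitivity (- (star_inv q' p (star_op q' p Y) - star_inv q' p (star_op q p Y)))%H.
- rewrite HX, (star_inv_op r q') by easy.
  generalize (star_inv q' p X), Y; clear; Hring.
- rewrite <- (H_linear_minus _ _ _ HL). f_equal; f_equal. apply star_op_sub.
Qed.

Lemma star_pow_neg_series_Dbar (q p : H) (r : R) (delta : posreal)
    (b : nat -> H) (phi : H -> H) :
  0 < r ->
  (forall q' : H, norm (q' - q)%H < delta ->
     op_ge r (star_op q' p) /\
     is_series (fun n => star_pow_neg q' p (S n) * b n)%H (phi q')) ->
  ex_series (fun n => INR (S n) ^ 2 * (/ r) ^ S n * norm (b n)) ->
  exists l : H,
    is_series (fun m =>
      R2poly (S m) q p * Qc_inv_pow (S m + 1) p q * ((-2) *: b m))%H l /\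
    is_Dbar phi q l.
Proof.
intros Hr Hphi Hb.
assert (Hrp := Rinv_0_lt_compat _ Hr). set (i := / r) in *.
assert (H0 : norm (q - q)%H < delta).
{ replace (q - q)%H with (RtoH 0) by (clear; Hring). rewrite norm_RtoH0. apply cond_pos. }
assert (Hq := proj1 (Hphi q H0)).
assert (HJq := star_inv_le r q p Hr Hq). fold i in HJq.
assert (Hsq := pow2_gt_0 i ltac:(lra)).
assert (Hstep : forall q' (h X : H), op_ge r (star_op q' p) ->
  norm (star_inv q' p (h * star_inv q p X)%H) <= i * (norm h * (i * norm X))).
{ intros q' h X Hq'. eapply Rle_trans; [apply (star_inv_le r q' p Hr Hq')|]. fold i.
  apply Rmult_le_compat_l; [lra|]. rewrite norm_mult.
  apply Rmult_le_compat_l; [apply norm_ge_0|apply HJq]. }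
(* The first-order bound is i^2 |h| and the second-order one i^3 |h|^2; both lie below C i times the
   power of |h| when C = i + i^2. *)
destruct (op_series_Dbar (fun q' => star_inv q' p)
  (fun X => star_op q p X * Hinv (Qpoly p q))%H
  (star_inv q p) (fun X => star_op q p X * Hinv (Qpoly p q))%H (-1) q i (i + i ^ 2)
  delta b phi) as (l & Hl & HD).
- lra.
- lra.
- intros q' Hq'; destruct (Hphi q' Hq') as [H1 H2].
  assert (Hn := norm_ge_0 (q' - q)%H).
  split; [apply (conj_pair_linear _ _ _ (conj_pair_star_inv q' p))|].
  split; [now apply star_inv_le|]. split; [|split].
  + intros X; rewrite (star_inv_sub r) by easy.
    assert (HX := norm_ge_0 X).
    rewrite norm_Hopp. eapply Rle_trans; [now apply Hstep|].
    assert (0 <= norm (q' - q)%H * norm X) by now apply Rmult_le_pos.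
    assert (0 <= i ^ 2 * i * (norm (q' - q)%H * norm X))
      by (repeat apply Rmult_le_pos; lra).
    nra.
  + intros X. assert (HX := norm_ge_0 X).
    set (Y := ((q' - q) * star_inv q p X)%H).
    (* The resolvent identity is used twice: the remainder is J' h J h J X, with h = q' - q. *)
    replace (star_inv q' p X - star_inv q p X - (-1) *: star_inv q p Y)%H with
      (- (star_inv q' p Y - star_inv q p Y))%H.
    2:{ rewrite (star_inv_sub r q q' p X) by easy. fold Y.
        generalize (star_inv q' p Y), (star_inv q p Y); clear; Hring. }
    rewrite (star_inv_sub r) by easy. unfold Y. rewrite !norm_Hopp.
    eapply Rle_trans; [now apply Hstep|]. rewrite norm_mult.
    assert (HJX := HJq X).
    assert (H3 : i * (norm (q' - q)%H * (i * (norm (q' - q)%H * norm (star_inv q p X))))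
      <= i * (norm (q' - q)%H * (i * (norm (q' - q)%H * (i * norm X))))).
    { repeat (apply Rmult_le_compat_l; [lra|]). exact HJX. }
    eapply Rle_trans; [exact H3|].
    assert (0 <= i * i * (norm (q' - q)%H ^ 2 * norm X)).
    { apply Rmult_le_pos; [nra|]. apply Rmult_le_pos; [apply pow2_ge_0|easy]. }
    nra.
  + eapply is_series_ext; [|exact H2]; intros n; cbn beta; now rewrite (star_pow_negE r).
- intros h X. replace ((-1) *: star_inv q p (h * star_inv q p X))%H with
    (- star_inv q p (h * star_inv q p X))%H
    by (generalize (star_inv q p (h * star_inv q p X)%H); clear; Hring).
  assert (HX := norm_ge_0 X). assert (Hn := norm_ge_0 h).
  rewrite norm_Hopp. eapply Rle_trans; [now apply Hstep|].
  assert (0 <= norm h * norm X) by now apply Rmult_le_pos.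
  assert (0 <= i ^ 2 * i * (norm h * norm X))
    by (repeat apply Rmult_le_pos; lra).
  nra.
- apply conj_pair_star_inv.
- apply conj_pair_star_inv.
- easy.
- exists l; split; [|easy]. eapply is_series_ext; [|exact Hl].
  intros m; cbn beta. now apply R2polyE.
Qed.

(** * Convergence on the annulus *)

Lemma ex_series_sq_geom (x : R) :
  0 < x < 1 -> ex_series (fun n => INR (S n) ^ 2 * x ^ S n).
Proof.
intros [Hx Hx1].
assert (Hpos : forall n, 0 < INR (S n) ^ 2 * x ^ S n).
{ intros n; apply Rmult_lt_0_compat; [|now apply pow_lt].
  apply pow_lt, lt_0_INR; lia. }
apply ex_series_ext with (fun n => Rabs (INR (S n) ^ 2 * x ^ S n)).
{ intros n; apply Rabs_pos_eq, Rlt_le, Hpos. }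
apply ex_series_DAlembert with x; [easy| |].
{ intros n; assert (H0 := Hpos n); lra. }
apply is_lim_seq_ext with (fun n => (1 + / INR (S n)) * (1 + / INR (S n)) * x).
{ intros n.
  assert (Hn : 0 < INR (S n)) by (apply lt_0_INR; lia).
  assert (Hxn : 0 < x ^ S n) by now apply pow_lt.
  rewrite Rabs_pos_eq by (apply Rlt_le, Rdiv_lt_0_compat; apply Hpos).
  change (x ^ S (S n)) with (x * x ^ S n). rewrite (S_INR (S n)).
  field. lra. }
assert (L : is_lim_seq (fun n => 1 + / INR (S n)) (1 + 0)).
{ apply is_lim_seq_plus'; [apply is_lim_seq_const|].
  apply (is_lim_seq_incr_1 (fun n => / INR n)).
  replace (Finite 0) with (Rbar_inv p_infty) by reflexivity.
  apply is_lim_seq_inv; [apply is_lim_seq_INR|easy]. }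
rewrite Rplus_0_r in L.
replace (Finite x) with (Finite (1 * 1 * x)) by (f_equal; ring).
apply is_lim_seq_mult'; [now apply is_lim_seq_mult'|apply is_lim_seq_const].
Qed.

Lemma nth_root_lt (n : nat) (x y : R) :
  (1 <= n)%nat -> 0 < y -> nth_root n x < y -> x <= y ^ n.
Proof.
intros Hn Hy; unfold nth_root; destruct (Rle_dec x 0) as [Hx|Hx]; intros H1.
- apply Rle_trans with 0; [easy|]. now apply Rlt_le, pow_lt.
- assert (Hx' : 0 < x) by lra.
  assert (Hn' : INR n <> 0) by (apply not_0_INR; lia).
  replace x with (Rpower x (/ INR n) ^ n).
  + apply pow_incr; split; [|lra]. apply Rlt_le, exp_pos.
  + rewrite <- Rpower_pow by apply exp_pos.
    now rewrite Rpower_mult, Rinv_l, Rpower_1.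
Qed.

Lemma ex_series_of_LimSup (b : nat -> H) (l r : R) :
  is_LimSup_seq (fun n => nth_root n (Hmod (b n))) l -> 0 < r -> r * l < 1 ->
  ex_series (fun n => INR (S n) ^ 2 * r ^ S n * norm (b (S n))).
Proof.
intros Hl Hr Hrl.
assert (Hrp := Rinv_0_lt_compat _ Hr).
assert (Hlr : l < / r).
{ apply (Rmult_lt_reg_l r); [easy|]. rewrite Rinv_r; lra. }
(* Root test: [l'] is strictly between the limsup and [/ r], and positive so that [nth_root_lt]
   applies. *)
set (l' := (Rmax l 0 + / r) / 2).
assert (Hm : Rmax l 0 < / r) by now apply Rmax_lub_lt.
assert (Hm0 := Rmax_l l 0). assert (Hm1 := Rmax_r l 0).
assert (Hl' : 0 < l') by (unfold l'; lra).
assert (Hll' : 0 < l' - l) by (unfold l'; lra).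
assert (Hrl' : r * l' < 1).
{ rewrite <- (Rinv_r r) by lra. apply Rmult_lt_compat_l; [easy|]. unfold l'; lra. }
destruct (Hl (mkposreal _ Hll')) as [_ [N HN]]; cbn in HN.
apply (ex_series_incr_n _ N).
apply (@ex_series_le R_AbsRing R_CompleteNormedModule) with
  (fun k => INR (S (N + k)) ^ 2 * (r * l') ^ S (N + k)).
- intros k. set (n := S (N + k)).
  assert (Hb : Hmod (b n) <= l' ^ n).
  { apply nth_root_lt; [lia|easy|].
    replace l' with (l + (l' - l)) by ring. apply HN; lia. }
  assert (H0 : 0 <= INR n ^ 2 * r ^ n).
  { apply Rmult_le_pos; [apply pow2_ge_0|]. now apply pow_le, Rlt_le. }
  assert (H1 := norm_ge_0 (b n)).
  change (Rabs (INR n ^ 2 * r ^ n * norm (b n)) <= INR n ^ 2 * (r * l') ^ n).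
  rewrite Rabs_pos_eq by now apply Rmult_le_pos.
  rewrite Rpow_mult_distr, <- Rmult_assoc, norm_HE.
  now apply Rmult_le_compat_l.
- apply (ex_series_incr_n (fun n => INR (S n) ^ 2 * (r * l') ^ S n)).
  apply ex_series_sq_geom; split; [now apply Rmult_lt_0_compat|easy].
Qed.

(** * Distances inside a slice and bounds for the star operator *)

(* The distance of [Re q + |Im q| I] to [a + b I]. *)
Definition slice_dist (a b : R) (q : H) : R :=
  norm (mkH (Hre q - a) (Hmod (Hvec q) - b) 0 0).

Lemma norm_mkH2 (u v : R) : norm (mkH u v 0 0) = sqrt (u ^ 2 + v ^ 2).
Proof. rewrite norm_HE; unfold Hmod; f_equal; cbn; ring. Qed.

Lemma Hmod_slice_sub (I : H) (x y a b : R) :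
  sphere I ->
  Hmod (slice_pt x y I - slice_pt a b I)%H = sqrt ((x - a) ^ 2 + (y - b) ^ 2).
Proof.
intros [HI0 HI1]. assert (HI := Hmod_sq I); rewrite HI1 in HI.
unfold Hmod; f_equal.
destruct I as [[[i0 i1] i2] i3]; unfold Hre in HI0; cbn in HI0; subst i0.
transitivity ((x - a) ^ 2 + (y - b) ^ 2 * (0 ^ 2 + i1 ^ 2 + i2 ^ 2 + i3 ^ 2)).
- clear; Hcoord_ring.
- change (1 ^ 2 = 0 ^ 2 + i1 ^ 2 + i2 ^ 2 + i3 ^ 2) in HI. rewrite <- HI; ring.
Qed.

Lemma slice_pt_Hre (I : H) (x y : R) : sphere I -> Hre (slice_pt x y I) = x.
Proof.
intros [HI0 _]; destruct I as [[[i0 i1] i2] i3]; unfold Hre in HI0; cbn in HI0; subst i0.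
clear; Hcoord_ring.
Qed.

Lemma slice_pt_Hmod_Hvec (I : H) (x y : R) :
  sphere I -> Hmod (Hvec (slice_pt x y I)) = Rabs y.
Proof.
intros [HI0 HI1]. assert (HI := Hmod_sq I); rewrite HI1 in HI.
unfold Hmod; rewrite <- sqrt_Rsqr_abs; f_equal.
destruct I as [[[i0 i1] i2] i3]; unfold Hre in HI0; cbn in HI0; subst i0.
transitivity (y ^ 2 * (0 ^ 2 + i1 ^ 2 + i2 ^ 2 + i3 ^ 2)).
- clear; Hcoord_ring.
- change (1 ^ 2 = 0 ^ 2 + i1 ^ 2 + i2 ^ 2 + i3 ^ 2) in HI. rewrite <- HI.
  unfold Rsqr; ring.
Qed.

(** The given [I] supplies an imaginary unit when [q] is real. *)
Lemma slice_polar (I q : H) :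
  sphere I -> exists J, sphere J /\ q = slice_pt (Hre q) (Hmod (Hvec q)) J.
Proof.
intros HI. set (m := Hmod (Hvec q)).
assert (Hm : m ^ 2 = Him1 q ^ 2 + Him2 q ^ 2 + Him3 q ^ 2).
{ unfold m; rewrite Hmod_sq; clear; Hcoord_ring. }
destruct (Req_dec m 0) as [H0|H0].
- exists I; split; [easy|]. rewrite H0 in *. clear m H0.
  assert (Him1 q = 0 /\ Him2 q = 0 /\ Him3 q = 0) as (E1 & E2 & E3)
    by (repeat split; nra).
  destruct q as [[[x0 x1] x2] x3].
  cbn in E1, E2, E3; subst. clear; Hring.
- exists ((/ m) *: Hvec q)%H; split; [split|].
  + clear; Hcoord_ring.
  + change (Hmod ((/ m) *: Hvec q)%H = 1). rewrite <- norm_HE, norm_Hscal, norm_HE.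
    fold m. assert (Hm0 : 0 <= m) by apply sqrt_pos.
    rewrite Rabs_pos_eq; [now apply Rinv_l|].
    apply Rlt_le, Rinv_0_lt_compat; lra.
  + clear Hm. clearbody m. unfold slice_pt.
    replace (m *: ((/ m) *: Hvec q))%H with ((m * / m) *: Hvec q)%H
      by (clear; Hring).
    rewrite Rinv_r by easy. clear; Hring.
Qed.

Lemma sqrt_sq_swap (u y b : R) :
  sqrt (u ^ 2 + (y - - b) ^ 2) = sqrt (u ^ 2 + (- y - b) ^ 2).
Proof. f_equal; ring. Qed.

(** Conjugating [p] instead of the point of the slice leaves the distance unchanged, so one point is
    measured against a + b I and a - b I. This depends on [q] only through Re q and |Im q|. *)
Lemma Omega_annulusE (p : H) (R1 : R) (R2 : Rbar) (q : H) :
  Omega_annulus p R1 R2 q <->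
  exists (I : H) (a b : R), sphere I /\ p = slice_pt a b I /\
    (R1 < slice_dist a b q /\ Rbar_lt (slice_dist a b q) R2) /\
    (R1 < slice_dist a (- b) q /\ Rbar_lt (slice_dist a (- b) q) R2).
Proof.
unfold slice_dist; split.
- intros (I & HI & (a & b & ->) & x & y & J & HJ & -> & (_ & H1) & (_ & H2)).
  rewrite !Hmod_slice_sub in H1, H2 by easy.
  exists I, a, b. rewrite slice_pt_Hre, slice_pt_Hmod_Hvec by easy.
  rewrite !norm_mkH2, !(sqrt_sq_swap _ _ b).
  (* For negative [y] the two conditions change places. *)
  unfold Rabs; destruct (Rcase_abs y); rewrite ?Ropp_involutive; tauto.
- intros (I & a & b & HI & -> & H1 & H2).
  exists I; split; [easy|]; split; [now exists a, b|].
  destruct (slice_polar I q HI) as (J & HJ & Eq).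
  exists (Hre q), (Hmod (Hvec q)), J. split; [easy|]; split; [easy|].
  rewrite norm_mkH2 in H1, H2. rewrite (sqrt_sq_swap _ _ b) in H2.
  unfold slice_annulus. rewrite !Hmod_slice_sub by easy.
  split; [split; [|exact H1]|split; [|exact H2]]; eexists; eexists; reflexivity.
Qed.

(** The map q |-> (Re q, |Im q|) is 1-Lipschitz, by the reverse triangle inequality on imaginary
    parts. *)
Lemma slice_dist_lip (a b : R) (q q' : H) :
  slice_dist a b q' <= slice_dist a b q + norm (q' - q)%H /\
  slice_dist a b q <= slice_dist a b q' + norm (q' - q)%H.
Proof.
assert (HL : forall q q' : H, slice_dist a b q' <= slice_dist a b q + norm (q' - q)%H).
{ clear; intros q q'; unfold slice_dist.
  replace (mkH (Hre q' - a) (Hmod (Hvec q') - b) 0 0) with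
    (mkH (Hre q - a) (Hmod (Hvec q) - b) 0 0 +
     mkH (Hre q' - Hre q) (Hmod (Hvec q') - Hmod (Hvec q)) 0 0)%H
    by (generalize (Hmod (Hvec q')), (Hmod (Hvec q)); Hring).
  eapply Rle_trans; [apply H_norm_triangle|]. apply Rplus_le_compat_l.
  rewrite norm_mkH2, (norm_HE (q' - q)%H). unfold Hmod at 3. apply sqrt_le_1_alt.
  assert (Hd : Rabs (Hmod (Hvec q') - Hmod (Hvec q)) <= norm (Hvec q' - Hvec q)%H).
  { rewrite <- !norm_HE. exact (norm_triangle_inv (Hvec q') (Hvec q)). }
  assert (Hd2 : (Hmod (Hvec q') - Hmod (Hvec q)) ^ 2 <= Hmod (Hvec q' - Hvec q)%H ^ 2).
  { rewrite <- (norm_HE (Hvec q' - Hvec q)%H).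
    rewrite <- (pow2_abs (Hmod (Hvec q') - Hmod (Hvec q))). apply pow_incr. split; [apply Rabs_pos|easy]. }
  rewrite Hmod_sq in Hd2. clear Hd.
  eapply Rle_trans; [apply Rplus_le_compat_l, Hd2|]. apply Req_le.
  clear; Hcoord_ring. }
split; [apply HL|]. replace (norm (q' - q)%H) with (norm (q - q')%H); [apply HL|].
rewrite <- norm_Hopp; f_equal. clear; Hring.
Qed.

(* With [P = |J X + X I| ^ 2] and [M = |J X - X I| ^ 2], which add up to
   [4 |X| ^ 2], [4 |q X - X p| ^ 2] is
   [P * slice_dist a b q ^ 2 + M * slice_dist a (- b) q ^ 2]. *)
Lemma star_op_bounds (I q : H) (a b s r : R) :
  sphere I -> 0 <= s ->
  s <= slice_dist a b q <= r -> s <= slice_dist a (- b) q <= r ->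
  op_ge s (star_op q (slice_pt a b I)) /\ op_le r (star_op q (slice_pt a b I)).
Proof.
intros HI Hs. unfold slice_dist; rewrite !norm_mkH2.
destruct (slice_polar I q HI) as (J & HJ & Eq).
set (x := Hre q) in *; set (y := Hmod (Hvec q)) in *. clearbody x y.
set (dp := (x - a) ^ 2 + (y - b) ^ 2). set (dm := (x - a) ^ 2 + (y - - b) ^ 2).
intros [Hp1 Hp2] [Hm1 Hm2].
assert (Hr : 0 <= r) by lra.
assert (Hdp : s ^ 2 <= dp <= r ^ 2).
{ assert (0 <= dp) by (apply Rplus_le_le_0_compat; apply pow2_ge_0). rewrite <- (pow2_sqrt dp) by easy.
  split; apply pow_incr; split; try easy. apply sqrt_pos. }
assert (Hdm : s ^ 2 <= dm <= r ^ 2).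
{ assert (0 <= dm) by (apply Rplus_le_le_0_compat; apply pow2_ge_0). rewrite <- (pow2_sqrt dm) by easy.
  split; apply pow_incr; split; try easy. apply sqrt_pos. }
subst q.
assert (HE : forall X, exists P M, 0 <= P /\ 0 <= M /\ P + M = 4 * norm X ^ 2 /\
  4 * norm (star_op (slice_pt x y J) (slice_pt a b I) X) ^ 2 = P * dp + M * dm).
{ intros X. exists (Hmod (J * X + X * I)%H ^ 2), (Hmod (J * X - X * I)%H ^ 2).
  split; [apply pow2_ge_0|]. split; [apply pow2_ge_0|].
  rewrite !norm_HE, !Hmod_sq.
  destruct HI as [HI0 HI1], HJ as [HJ0 HJ1].
  assert (HI := Hmod_sq I); rewrite HI1 in HI.
  assert (HJ := Hmod_sq J); rewrite HJ1 in HJ.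
  destruct I as [[[i0 i1] i2] i3], J as [[[j0 j1] j2] j3], X as [[[x0 x1] x2] x3].
  unfold Hre in HI0, HJ0; cbn in HI0, HJ0; subst i0 j0.
  change (1 ^ 2 = 0 ^ 2 + i1 ^ 2 + i2 ^ 2 + i3 ^ 2) in HI.
  change (1 ^ 2 = 0 ^ 2 + j1 ^ 2 + j2 ^ 2 + j3 ^ 2) in HJ.
  (* Solving each unit-sphere equation for one square lets [ring] work modulo both. *)
  assert (EI : i1 ^ 2 = 1 - i2 ^ 2 - i3 ^ 2) by lra.
  assert (EJ : j1 ^ 2 = 1 - j2 ^ 2 - j3 ^ 2) by lra.
  unfold dp, dm. clear - EI EJ.
  split; cbv - [Rplus Rmult Ropp Rminus Rinv Rdiv IZR] in EI, EJ |- *; ring [EI EJ]. }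
assert (Hsq : forall u v, 0 <= v -> u ^ 2 <= v ^ 2 -> u <= v)
  by (intros u v Hv Huv; apply Rnot_lt_le; intros Hlt; nra).
split; intros X; destruct (HE X) as (P & M & HP & HM & HPM & Hn);
  assert (HX := norm_ge_0 X); apply Hsq.
- apply norm_ge_0.
- rewrite Rpow_mult_distr. nra.
- now apply Rmult_le_pos.
- rewrite Rpow_mult_distr. nra.
Qed.

Lemma Rbar_lt_between (d : R) (B : Rbar) :
  Rbar_lt d B -> exists r : R, d < r /\ Rbar_lt r B.
Proof.
destruct B as [b| |]; cbn; intros Hd.
- exists ((d + b) / 2); lra.
- exists (d + 1); split; [lra|easy].
- easy.
Qed.

(** One ball carries membership and both operator bounds with fixed radii. The strict inequalities
    [R1 < s] and [r < R2] make the coefficient series converge. *)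
Lemma Omega_annulus_locally (p : H) (R1 : R) (R2 : Rbar) (q : H) :
  0 < R1 -> Omega_annulus p R1 R2 q ->
  exists (s r : R) (delta : posreal),
    R1 < s /\ 0 < r /\ Rbar_lt r R2 /\
    forall q' : H, norm (q' - q)%H < delta ->
      Omega_annulus p R1 R2 q' /\
      op_ge s (star_op q' p) /\ op_le r (star_op q' p).
Proof.
intros HR1 HO; apply Omega_annulusE in HO.
destruct HO as (I & a & b & HI & -> & (H1 & H2) & (H3 & H4)).
(* Finite radii are picked below [R2], which may be infinite. *)
destruct (Rbar_lt_between _ _ H2) as (rp & Hrp & Hrp2).
destruct (Rbar_lt_between _ _ H4) as (rm & Hrm & Hrm2).
set (dp := slice_dist a b q) in *. set (dm := slice_dist a (- b) q) in *.
set (s := (R1 + Rmin dp dm) / 2). set (r := Rmax rp rm).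
assert (Hmin : R1 < Rmin dp dm) by now apply Rmin_glb_lt.
assert (Hs : R1 < s < Rmin dp dm) by (unfold s; lra).
assert (Hr2 : Rbar_lt r R2) by (unfold r; destruct (Rmax_case_strong rp rm (fun x => x = rp \/ x = rm)) as [->| ->]; auto).
assert (L1 := Rmin_l dp dm). assert (L2 := Rmin_r dp dm).
assert (L3 := Rmax_l rp rm). assert (L4 := Rmax_r rp rm). fold r in L3, L4.
(* Slice distances move by at most |q' - q|, so these margins keep both of them between [s] and
   [r]. *)
set (d := Rmin (Rmin dp dm - s) (Rmin (rp - dp) (rm - dm))).
assert (Hd : 0 < d) by (unfold d; repeat apply Rmin_glb_lt; lra).
assert (Hd1 : d <= Rmin dp dm - s) by apply Rmin_l.
assert (Hd2 : d <= rp - dp) by (eapply Rle_trans; [apply Rmin_r|apply Rmin_l]).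
assert (Hd3 : d <= rm - dm) by (eapply Rle_trans; [apply Rmin_r|apply Rmin_r]).
exists s, r, (mkposreal d Hd).
split; [lra|]. split; [lra|]. split; [easy|].
intros q' Hq'; change (norm (q' - q)%H < d) in Hq'.
destruct (slice_dist_lip a b q q') as [Lp1 Lp2].
destruct (slice_dist_lip a (- b) q q') as [Lm1 Lm2].
fold dp in Lp1, Lp2. fold dm in Lm1, Lm2.
split.
- apply Omega_annulusE. exists I, a, b. split; [easy|]. split; [easy|].
  split; (split; [lra|]); (eapply Rbar_le_lt_trans; [|exact Hr2]); cbn [Rbar_le]; lra.
- apply star_op_bounds; try easy; lra.
Qed.

(** * Pointwise sums and locality of Dbar *)

Lemma H_compact_singleton (q : H) : H_compact (fun x => x = q).
Proof.
intros T V _ HV. destruct (HV q eq_refl) as [t Ht].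
exists (t :: nil)%list. intros x ->. exists t; split; [now left|easy].
Qed.

Lemma cv_abs_unif_compact_series (A : H -> Prop) (u : nat -> H -> H) (s : H -> H) (q : H) :
  cv_abs_unif_compact A u s -> A q -> is_series (fun n => u n q) (s q).
Proof.
intros [_ Hu] Hq. apply filterlim_locally_ball_norm; intros eps.
destruct (Hu (fun x => x = q) (H_compact_singleton q)
  ltac:(intros x ->; exact Hq) eps) as [N HN].
exists N; intros n Hn. assert (H1 := HN n Hn q eq_refl).
rewrite <- norm_HE in H1. exact H1.
Qed.

Lemma is_Dbar_plus_const (f g : H -> H) (c q l m : H) :
  is_Dbar f q l -> is_Dbar g q m ->
  is_Dbar (fun x => f x + g x + c)%H q (l + m)%H.
Proof.
intros (f0 & f1 & f2 & f3 & F0 & F1 & F2 & F3 & ->)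
  (g0 & g1 & g2 & g3 & G0 & G1 & G2 & G3 & ->).
assert (HD : forall (u v : R -> H) t (du dv : H),
  is_derive u t du -> is_derive v t dv ->
  is_derive (fun t => u t + v t + c)%H t (du + dv)%H).
{ intros u v t du dv Hu Hv. rewrite <- (plus_zero_r (du + dv)%H).
  exact (is_derive_plus _ _ _ _ _ (is_derive_plus _ _ _ _ _ Hu Hv) (is_derive_const c t)). }
exists (f0 + g0)%H, (f1 + g1)%H, (f2 + g2)%H, (f3 + g3)%H.
do 4 (split; [now apply HD|]).
revert f0 f1 f2 f3 g0 g1 g2 g3 F0 F1 F2 F3 G0 G1 G2 G3; clear.
intros ? ? ? ? ? ? ? ? _ _ _ _ _ _ _ _; Hring.
Qed.

Lemma is_Dbar_ext_loc (f g : H -> H) (q l : H) (delta : posreal) :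
  (forall q' : H, norm (q' - q)%H < delta -> f q' = g q') ->
  is_Dbar f q l -> is_Dbar g q l.
Proof.
intros Hfg (d0 & d1 & d2 & d3 & D0 & D1 & D2 & D3 & ->).
assert (Hext : forall (gam : R -> H) (t0 : R) (e d : H),
  norm e = 1 -> (forall t, (gam t - q)%H = ((t - t0) *: e)%H) ->
  is_derive (fun t => f (gam t)) t0 d -> is_derive (fun t => g (gam t)) t0 d).
{ intros gam t0 e d He Hgam; apply is_derive_ext_loc.
  exists delta; intros t Ht. apply Hfg. rewrite Hgam, norm_Hscal, He, Rmult_1_r.
  exact Ht. }
destruct norm_basis as (N0 & N1 & N2 & N3).
exists d0, d1, d2, d3.
split; [|split; [|split; [|split; [|easy]]]].
- apply (Hext (fun t => mkH t (Him1 q) (Him2 q) (Him3 q)) _ Hone); try easy.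
  clear; revert q; Hring.
- apply (Hext (fun t => mkH (Hre q) t (Him2 q) (Him3 q)) _ e1); try easy.
  clear; revert q; Hring.
- apply (Hext (fun t => mkH (Hre q) (Him1 q) t (Him3 q)) _ e2); try easy.
  clear; revert q; Hring.
- apply (Hext (fun t => mkH (Hre q) (Him1 q) (Him2 q) t) _ e3); try easy.
  clear; revert q; Hring.
Qed.

Theorem theorem10p5 (Omega : H -> Prop) (f : H -> H) (p : H) (a : Z -> H)
    (R1 : R) (R2 : Rbar)
    (hOpen : open Omega)
    (hSym : axially_symmetric Omega)
    (hf : slice_hyperholomorphic Omega f)
    (hR2 : is_LimSup_seq
             (fun n : nat => nth_root n (Hmod (a (Z.of_nat n)))) (Rbar_inv R2))
    (hR1 : is_LimSup_seq
             (fun n : nat => nth_root n (Hmod (a (- Z.of_nat n)%Z))) R1)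
    (hR1pos : 0 < R1)
    (hR12 : Rbar_lt R1 R2)
    (hSub : forall q : H, Omega_annulus p R1 R2 q -> Omega q)
    (hExp : star_Laurent_expansion (Omega_annulus p R1 R2) f p a)
    (c : Z -> H)
    (hcpos : forall n : nat,
       c (Z.of_nat n) = ((2 * INR (n + 1)) *: a (Z.of_nat (n + 1)))%H)
    (hcneg : forall n : nat, (1 <= n)%nat ->
       c (- Z.of_nat n)%Z = ((-2) *: a (- Z.of_nat n)%Z)%H)
    (q : H) (hq : Omega_annulus p R1 R2 q) :
  exists s t : H,
    is_series (fun n : nat => (Ptilde2 n q p * c (Z.of_nat n))%H) s /\
    is_series (fun n : nat =>
      (R2poly (S n) q p * Qc_inv_pow (S n + 1) p q
         * c (- Z.of_nat (S n))%Z)%H) t /\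
    is_Dbar f q (s + t)%H.
Proof.
destruct (Omega_annulus_locally p R1 R2 q hR1pos hq)
  as (s & r & delta & Hs & Hr & HrR2 & Hloc).
destruct hExp as (g & h & Hg & Hh & Hf).
assert (Hrs := Rinv_0_lt_compat s ltac:(lra)).
(* The termwise lemma sums from the first power on, so the constant [a 0] is subtracted from [g]. *)
destruct (star_pow_series_Dbar q p r delta (fun n => a (Z.of_nat (S n)))
  (fun x => (g x - a 0%Z)%H)) as (l & Hl & HDl).
- easy.
- intros q' Hq'. destruct (Hloc q' Hq') as (HO & _ & Hle). split; [easy|].
  assert (HS := cv_abs_unif_compact_series _ _ _ q' Hg HO).
  replace (g q') with ((g q' - a 0%Z) + star_pow q' p 0 * a (Z.of_nat 0))%H in HS.
  + exact (is_series_incr_1 (V := H_NormedModule) _ _ HS).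
  + rewrite star_powE. cbn [Nat.iter nat_rect Z.of_nat].
    generalize (g q'), (a 0%Z); clear; Hring.
- apply ex_series_of_LimSup with (b := fun n => a (Z.of_nat n)) (l := Rbar_inv R2).
  (* [Rbar_inv R2] is read as a real number; it is 0 for an infinite radius. *)
  + destruct R2; exact hR2.
  + easy.
  + destruct R2 as [B| |]; cbn in *; [|lra|easy].
    assert (HB := Rinv_0_lt_compat B ltac:(lra)).
    rewrite <- (Rinv_r B) by lra. now apply Rmult_lt_compat_r.
- destruct (star_pow_neg_series_Dbar q p s delta (fun n => a (- Z.of_nat (S n))%Z) h)
    as (m & Hm & HDm).
  + lra.
  + intros q' Hq'. destruct (Hloc q' Hq') as (HO & Hge & _). split; [easy|].
    exact (cv_abs_unif_compact_series _ _ _ q' Hh HO).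
  + apply ex_series_of_LimSup with (b := fun n => a (- Z.of_nat n)%Z) (l := R1).
    * exact hR1.
    * easy.
    * rewrite <- (Rinv_l s) by lra. now apply Rmult_lt_compat_l.
  + exists l, m. split; [|split].
    * eapply is_series_ext; [|exact Hl]. intros n; cbn beta.
      now rewrite hcpos, Nat.add_1_r.
    * eapply is_series_ext; [|exact Hm]. intros n; cbn beta.
      rewrite hcneg by lia. reflexivity.
    (* The constant is put back; its Dbar is 0, and the expansion equals [f] on a whole ball around
       [q]. *)
    * apply is_Dbar_ext_loc with (fun x => g x - a 0%Z + h x + a 0%Z)%H delta.
      -- intros q' Hq'. rewrite Hf by apply (Hloc q' Hq').
         generalize (g q'), (h q'), (a 0%Z); clear; Hring.
      -- now apply is_Dbar_plus_const.
Qed.
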